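(* Let $d\ge1$, let $f\in L^2(\mathbb R^d)$ and, for $L>0$, let $\Xi_L$ be the determinantal point process with intensity $L^d$ induced by the Bessel kernel $$K_L(x,y)=2^{d/2}\,\Gamma\left(\tfrac d2+1\right)\frac{L^{d/2}J_{d/2}(L\pi|x-y|)}{(\pi|x-y|)^{d/2}},$$ the variance of its linear statistics being understood as $$\operatorname{Var}\Big(\sum_{x\in\Xi_L}f(x)\Big)=\frac12\iint_{\mathbb R^d\times\mathbb R^d}|f(x)-f(y)|^2\,|K_L(x,y)|^2\,dxdy .$$ Then $$\lim_{L\to\infty}\frac1{L^{d-1}}\operatorname{Var}\Big(\sum_{x\in\Xi_L}f(x)\Big)=\frac{2^{d-1}\Gamma\left(\frac d2+1\right)^2}{\pi^{d+2}}\iint_{\mathbb R^d\times\mathbb R^d}\frac{|f(x)-f(y)|^2}{|x-y|^{d+1}}\,dxdy .$$ In particular, the limit is finite if and only if $f\in H^{1/2}(\mathbb R^d)$.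
   Context: Functions are real-valued. $J_\alpha$ is the Bessel function of the first kind. The background measure of the process is Lebesgue measure on $\mathbb R^d$. $H^{1/2}(\mathbb R^d)$ is the space of $f\in L^2(\mathbb R^d)$ with $\iint_{\mathbb R^d\times\mathbb R^d}\frac{|f(x)-f(y)|^2}{|x-y|^{d+1}}\,dxdy<\infty$. A determinantal point process with kernel $K$ is a simple point process with joint intensities $\det(K(x_i,x_j))_{i,j=1}^\ell$, $\ell\ge1$. The paper's standing convention is that all processes are of projection type, for which the variance of a linear statistic is given by the double integral formula in the claim; every assertion of the statement is to be read as an assertion about that double integral. For $d=1$, $K_L(x,y)=\frac{\sin L\pi(x-y)}{\pi(x-y)}$ is the sine kernel. *)

(* Defs.v *)
From HB Require Import structures.
From mathcomp Require Import all_boot all_order all_algebra.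
From mathcomp Require Import all_classical all_reals all_analysis.

Set Implicit Arguments.
Unset Strict Implicit.
Unset Printing Implicit Defensive.

Import Order.TTheory GRing.Theory Num.Theory.
Import numFieldNormedType.Exports.

Local Open Scope classical_set_scope.
Local Open Scope ring_scope.

(* R^d with its product (= Borel) sigma-algebra.  Tuples are used rather than
   ['rV[R]_d] because only the former carry a measurable structure. *)
Notation euclidean R d := (d.-tuple (measurableTypeR R)).

Section euclidean_lebesgue.
Context (R : realType).

Definition econs (d : nat) (p : measurableTypeR R * euclidean R d) :
  euclidean R d.+1 := [tuple of p.1 :: p.2].

Lemma measurable_econs d : measurable_fun [set: _] (@econs d).
Proof. exact: measurable_cons. Qed.

(* Lebesgue measure on R^0 is the unit mass at the only point; on R^(d+1) it is
   the image of the product of the Lebesgue measures on R and R^d under the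
   identification of R * R^d with R^(d+1). *)
Fixpoint lebesgue_euclidean (d : nat) : set (euclidean R d) -> \bar R :=
  match d return set (euclidean R d) -> \bar R with
  | 0 => fun A => \d_([tuple] : euclidean R 0) A
  | d'.+1 => pushforward
      (product_measure1 (@lebesgue_measure R) (@lebesgue_euclidean d'))
      (@econs d')
  end.

Lemma lebesgue_euclidean_sigma_finite_measure d :
  exists m : {sigma_finite_measure set (euclidean R d) -> \bar R},
    @lebesgue_euclidean d = m.
Proof.
elim: d => [|d [m Em]]; first by exists (\d_([tuple] : euclidean R 0)).
pose L : {sigma_finite_measure set (measurableTypeR R) -> \bar R} :=
  lebesgue_measure.
pose M : {measure set (measurableTypeR R * euclidean R d)%type -> \bar R} :=
  product_measure1 L m.
have sM : sigma_finite [set: _] M.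
  have /sigma_finiteP[F [TF ndF Foo]] := sigma_finiteT L.
  have /sigma_finiteP[G [TG ndG Goo]] := sigma_finiteT m.
  exists (fun n => F n `*` G n).
    rewrite -setXTT TF TG predeqE => -[x y]; split.
      move=> [/= [n _ Fnx] [k _ Gky]]; exists (maxn n k) => //; split.
      - by move: x Fnx; exact/subsetPset/ndF/leq_maxl.
      - by move: y Gky; exact/subsetPset/ndG/leq_maxr.
    by move=> [n _ []/= ? ?]; split; exists n.
  move=> k; have [? ?] := Foo k; have [? ?] := Goo k.
  split; first exact: measurableX.
  by rewrite /M/= product_measure1E// lte_mul_pinfty// ge0_fin_numE.
pose P : {measure set (euclidean R d.+1) -> \bar R} :=
  measure_function_pushforward__canonical__measure_function_Measure
    M (@measurable_econs d).
have sP : sigma_finite [set: _] P.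
  have [F TF Foo] := sM.
  pose un (x : euclidean R d.+1) : measurableTypeR R * euclidean R d :=
    (thead x, [tuple of behead x]).
  have mun : measurable_fun [set: _] un.
    apply/measurable_fun_pairP; split; first exact: measurable_tnth.
    exact: measurable_behead.
  have unK p : un (econs p) = p.
    by case: p => a t; congr pair; apply/val_inj.
  exists (fun n => un @^-1` F n).
    by rewrite -preimage_bigcup -TF preimage_setT.
  move=> n; have [mF Fn] := Foo n; split.
    by rewrite -[X in measurable X]setTI; exact: mun.
  rewrite /P/= /pushforward -comp_preimage.
  by rewrite (_ : un \o @econs d = id)//; apply/funext => p; exact: unK.
pose cP := isMeasure.Build _ _ _ (Measure.sort P)
  (measure0 P) (measure_ge0 P) (@measure_semi_sigma_additive _ _ _ P).
pose sfP := @Measure_isSigmaFinite.Build _ _ _ (Measure.sort P) sP.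
pose Q := HB.pack_for {sigma_finite_measure set (euclidean R d.+1) -> \bar R}
  (Measure.sort P) cP sfP.
by exists Q; rewrite /= Em.
Qed.

Let lebesgue_euclidean0 d : @lebesgue_euclidean d set0 = 0%E.
Proof.
have [m ->] := lebesgue_euclidean_sigma_finite_measure d; exact: measure0.
Qed.

Let lebesgue_euclidean_ge0 d A : (0 <= @lebesgue_euclidean d A)%E.
Proof.
have [m ->] := lebesgue_euclidean_sigma_finite_measure d; exact: measure_ge0.
Qed.

Let lebesgue_euclidean_sigma_additive d :
  semi_sigma_additive (@lebesgue_euclidean d).
Proof.
have [m ->] := lebesgue_euclidean_sigma_finite_measure d.
exact: measure_semi_sigma_additive.
Qed.

HB.instance Definition _ d := isMeasure.Build _ _ _ (@lebesgue_euclidean d)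
  (@lebesgue_euclidean0 d) (@lebesgue_euclidean_ge0 d)
  (@lebesgue_euclidean_sigma_additive d).

Let lebesgue_euclidean_sigma_finite d :
  sigma_finite [set: _] (@lebesgue_euclidean d).
Proof.
have [m ->] := lebesgue_euclidean_sigma_finite_measure d; exact: sigma_finiteT.
Qed.

HB.instance Definition _ d := Measure_isSigmaFinite.Build _ _ _
  (@lebesgue_euclidean d) (@lebesgue_euclidean_sigma_finite d).

End euclidean_lebesgue.
Arguments lebesgue_euclidean : clear implicits.
Arguments econs {R d} p.

Section euclidean_distance.
Context (R : realType) (d : nat).

(* The norm that MathComp-Analysis puts on vectors is the sup norm, hence this
   explicit Euclidean distance. *)
Definition edist (x y : euclidean R d) : R :=
  Num.sqrt (\sum_(i < d) ((tnth x i : R) - (tnth y i : R)) ^+ 2).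

End euclidean_distance.

Section special_functions.
Context (R : realType).

Definition Gamma (a : R) : R :=
  \int[@lebesgue_measure R]_(t in `]0, +oo[) (t `^ (a - 1) * expR (- t)).

(* Bessel function of the first kind, meant for order [0 <= a] and argument
   [0 <= x] (where [powR] and the integral defining [Gamma] are genuine). *)
Definition besselJ (a x : R) : R :=
  limn (series (fun m : nat =>
    (-1) ^+ m / (m`!%:R * Gamma (m%:R + a + 1))
      * (x / 2) `^ (m.*2%:R + a))).

End special_functions.

Section bessel_process.
Context (R : realType) (d : nat).

(* The formula reads 0/0 on the diagonal; the kernel is extended there by
   continuity, its value being the intensity [L ^+ d]. *)
Definition bessel_kernel (L : R) (x y : euclidean R d) : R :=
  if x == y then L ^+ d else
  2 `^ (d%:R / 2) * Gamma (d%:R / 2 + 1)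
    * (L `^ (d%:R / 2) * besselJ (d%:R / 2) (L * pi * edist x y))
    / (pi * edist x y) `^ (d%:R / 2).

Local Open Scope ereal_scope.

Let leb := @lebesgue_euclidean R d.

(* Variance of the linear statistic of [f] under the determinantal process with
   kernel [K] and background measure Lebesgue, in the form valid for processes
   of projection type.  It is taken as the definition because for [2 <= d] the
   operator with kernel [bessel_kernel L] is a projection times a constant
   larger than 1, so that it is not the kernel of an actual process. *)
Definition linear_statistic_variance
    (K : euclidean R d -> euclidean R d -> R) (f : euclidean R d -> R) :
    \bar R :=
  (2^-1)%:E * \int[product_measure1 leb leb]_z
    (`|f z.1 - f z.2| ^+ 2 * `|K z.1 z.2| ^+ 2)%:E.

(* Only the diagonal is affected by the convention [0^-1 = 0], and the
   numerator vanishes there. *)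
Definition gagliardo_half (f : euclidean R d -> R) : \bar R :=
  \int[product_measure1 leb leb]_z
    (`|f z.1 - f z.2| ^+ 2 / edist z.1 z.2 ^+ d.+1)%:E.

Definition Sobolev_half (f : euclidean R d -> R) : Prop :=
  f \in Lfun leb 2%:E /\ gagliardo_half f < +oo.

End bessel_process.

(* Main.v *)
Require Import Defs.
From mathcomp Require Import all_boot all_order all_algebra.
From mathcomp Require Import all_classical all_reals all_analysis.
From mathcomp Require Import measurable_realfun.
From mathcomp Require Import ring lra.

Import Order.TTheory GRing.Theory Num.Theory.
Import numFieldNormedType.Exports.

Local Open Scope classical_set_scope.
Local Open Scope ring_scope.

(** Put a = d/2 and let phi_d(s) = 2^a Gamma(a+1) J_a(s) / s^a, an entire
    function of s^2 with phi_d(0) = 1.  The kernel is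
    K_L(x,y) = L^d phi_d(L pi |x-y|), so with r = |x-y| and the Gagliardo weight
    F(x,y) = |f(x)-f(y)|^2 / r^(d+1) the rescaled variance is
<<
      1 / (2 pi^(d+1)) * \iint F(x,y) g(L pi r) dx dy,
      g(s) = s^(d+1) phi_d(s)^2.
>>
    The profile g is bounded and oscillates around a positive mean, and the
    theorem says that for large L only the mean matters.  Write
    2 g = energy + osc, where energy = s^(d+1) (phi_d^2 + phi_d'^2) and
    osc = s^(d+1) (phi_d^2 - phi_d'^2).  Three facts are needed.

    - The energy converges ([energy_cvg]).  By the Bessel equation a small
      correction of the energy brings its derivative down to the order of
      energy / s^2, so that the corrected energy times exp((d+1)/s) is
      nonincreasing for large s.

    - The limit is 2^(d+1) Gamma(d/2+1)^2 / pi ([energy_lim_Gamma]).  The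
      contiguity relations between phi_d and phi_(d+2) multiply it by (d+2)^2
      when d grows by 2, as they do the right-hand side; d = 1 is the sine
      function.  For d = 0, where the limit is 2/pi, the moments
      \int s^k phi_d^2 ds are computed along even d: asymptotically they are
      Wallis integrals times a constant, which is 1/pi in one parity class of
      d - k and half the unknown limit in the other, and the Cauchy-Schwarz
      inequality between consecutive moments forces the two constants to agree
      ([energy_lim0]).  No asymptotic expansion of Bessel functions is used.

    - The oscillating part averages out ([weak_null_euclidean_pairs]).  The
      function osc is the derivative of the bounded function
      -s^(d+1) phi_d phi_d'.  Along a line in x, the integral of
      h(x) osc(l |x-y|) therefore tends to 0 as l grows: by parts if h is the
      indicator of an interval that avoids the point closest to y, and by density
      for every integrable h.  Fubini and dominated convergence carry this over
      to the integral in x and y.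

    If F is integrable, dominated convergence treats what remains of g, since
    r > 0 wherever F does not vanish.  If \iint F is infinite, nonnegativity of
    g and the integrable case for truncations of F show that the variance
    tends to infinity ([radial_average]).  This gives the limit in [0, +oo],
    and its finiteness is that of \iint F because the constant is positive. *)

(** * Normalised Bessel functions *)

Section bessel_series.
Context {R : realType}.
Implicit Types (d m n : nat) (s x : R).

(** The factor 4^m m! Gamma(m+1+d/2) / Gamma(1+d/2) of the Bessel series of order
    d/2, as a product of integers: the whole analysis of [phi] can then be done
    before any value of Gamma is known. *)
Definition phi_den d m : nat := \prod_(j < m) ((j.+1).*2 * ((j.+1).*2 + d))%N.

Definition phi_coef d : R^nat := fun m => (-1) ^+ m / (phi_den d m)%:R.

(** phi_d(s) = 2^a Gamma(a+1) J_a(s) / s^a with a = d/2; see [besselJ_phi]. *)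
Definition phi d s : R := limn (pseries (phi_coef d) (s ^+ 2)).

Lemma phi_denS d m :
  phi_den d m.+1 = (phi_den d m * (m.+1.*2 * (m.+1.*2 + d)))%N.
Proof. by rewrite /phi_den big_ord_recr. Qed.

(** This is what turns a derivative of the series for d into the series for
    d + 2. *)
Lemma phi_den_shift d m :
  phi_den d m.+1 = (m.+1.*2 * (d + 2) * phi_den (d + 2) m)%N.
Proof.
elim: m => [|m IH].
  by rewrite /phi_den big_ord1 big_ord0 muln1 addnC.
rewrite phi_denS IH phi_denS -!muln2.
have -> : (m.+1 * 2 + (d + 2) = m.+2 * 2 + d)%N.
  by rewrite [(d + 2)%N]addnC addnA; congr addn; rewrite -[in RHS]addn1 mulnDl.
ring.
Qed.

Lemma phi_den_gt0 d m : (0 < phi_den d m)%N.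
Proof.
by apply: prodn_gt0 => j; rewrite muln_gt0 double_gt0/= addn_gt0 double_gt0.
Qed.

Lemma phi_den_neq0 d m : (phi_den d m)%:R != 0 :> R.
Proof. by rewrite pnatr_eq0 -lt0n phi_den_gt0. Qed.

Lemma phi_den_fact d m : (m`! <= phi_den d m)%N.
Proof.
elim: m => [|m IH]; first by rewrite /phi_den big_ord0.
rewrite phi_denS factS mulnC leq_mul//.
by rewrite -muln2 -mulnA -[leqLHS]muln1 leq_mul2l/= muln_gt0/= addn_gt0.
Qed.

Lemma norm_phi_coef_le d m : `|phi_coef d m| <= m`!%:R^-1.
Proof.
rewrite /phi_coef normrM normrX normrN1 expr1n mul1r ger0_norm ?invr_ge0//.
by rewrite lef_pV2 ?posrE ?ltr0n ?phi_den_gt0 ?fact_gt0// ler_nat phi_den_fact.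
Qed.

Lemma is_cvg_pseries_phi d x : cvgn (pseries (phi_coef d) x).
Proof.
apply: normed_cvg.
apply: (@series_le_cvg _ _ (exp_coeff `|x|)) => [n|n|n|].
- exact: normr_ge0.
- by rewrite /exp_coeff/= divr_ge0 ?exprn_ge0.
- rewrite /= /exp_coeff/= normrM normrX mulrC ler_wpM2l//.
  exact: norm_phi_coef_le.
- exact: is_cvg_series_exp_coeff.
Qed.

(** Termwise differentiation in the variable x = s^2. *)
Lemma phi_coef_diffs d :
  pseries_diffs (phi_coef d) = - (2 * (d + 2)%:R)^-1 *: phi_coef (d + 2).
Proof.
apply/funext => m; rewrite /pseries_diffs /phi_coef phi_den_shift.
rewrite [RHS](_ : _ = - (2 * (d + 2)%:R)^-1 * ((-1) ^+ m / (phi_den (d + 2) m)%:R))//.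
rewrite exprS -mul2n !natrM.
have := phi_den_neq0 (d + 2) m.
have h1 : (d + 2)%:R != 0 :> R by rewrite pnatr_eq0 addn2.
have h2 : (m.+1)%:R != 0 :> R by rewrite pnatr_eq0.
move: h1 h2; set u := (d + 2)%:R; set w := m.+1%:R; set z := (phi_den _ _)%:R.
by move=> h1 h2 h3; clearbody u w z; field; rewrite h1 h2 h3.
Qed.

Lemma pseriesZ (k : R) (c : R^nat) x : pseries (k *: c) x = k *: pseries c x.
Proof.
rewrite /pseries; apply/funext => n; rewrite /series/=.
rewrite [RHS](_ : _ = k * \sum_(0 <= i < n) (c i * x ^+ i))// mulr_sumr.
by apply: eq_bigr => i _; rewrite -mulrA.
Qed.

Lemma limn_pseriesZ (k : R) d x :
  limn (pseries (k *: phi_coef d) x) = k * limn (pseries (phi_coef d) x).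
Proof.
by rewrite pseriesZ limZl_tmp//; exact: is_cvg_pseries_phi.
Qed.

Lemma is_derive_phi_series d x :
  is_derive x (1 : R) (fun x => limn (pseries (phi_coef d) x))
    (- (2 * (d + 2)%:R)^-1 * limn (pseries (phi_coef (d + 2)) x)).
Proof.
have cZ k d' K : cvgn (pseries (k *: phi_coef d' : R^nat) K).
  by rewrite pseriesZ; apply: is_cvgZr; exact: is_cvg_pseries_phi.
rewrite -limn_pseriesZ -phi_coef_diffs.
apply: (@pseries_snd_diffs _ _ (`|x| + 1)).
- exact: is_cvg_pseries_phi.
- by rewrite phi_coef_diffs; exact: cZ.
- rewrite phi_coef_diffs.
  have -> (k : R) (c : R^nat) : pseries_diffs (k *: c) = k *: pseries_diffs c.
    apply/funext => i; rewrite /pseries_diffs.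
    by rewrite [LHS](_ : _ = i.+1%:R * (k * c i.+1))// mulrCA.
  by rewrite phi_coef_diffs scalerA; exact: cZ.
- by rewrite [ltRHS]ger0_norm ?addr_ge0// ltrDl.
Qed.

Definition dphi d s := - (s / (d + 2)%:R) * phi (d + 2) s.

Lemma is_derive_phi d s : is_derive s (1 : R) (phi d) (dphi d s).
Proof.
have := is_derive_phi_series d (s ^+ 2) => h.
rewrite /dphi /phi -[X in is_derive _ _ X _]/((fun x => limn (pseries (phi_coef d) x)) \o (fun s => s ^+ 2)).
apply: is_derive_eq.
rewrite /= -[LHS]/((_ *: _) : R)/=.
have : (d + 2)%:R != 0 :> R by rewrite pnatr_eq0 addn2.
rewrite /GRing.scale/=; set u := (d + 2)%:R => u0; clearbody u.
by field; rewrite u0.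
Qed.

Lemma phi_den_shift2 d m :
  ((d + 2) * phi_den (d + 2) m = (m.+1.*2 + d) * phi_den d m)%N.
Proof.
have := phi_den_shift d m; rewrite phi_denS => h; apply/eqP.
rewrite -(@eqn_pmul2l (m.+1.*2)) ?double_gt0//; apply/eqP.
by rewrite mulnA -h; ring.
Qed.

Lemma phi_coef_three_term d m :
  phi_coef (d + 2) m.+1 - phi_coef d m.+1 =
  ((d + 2)%:R * (d + 4)%:R)^-1 * phi_coef (d + 4) m.
Proof.
have e4 : (d + 2 + 2 = d + 4)%N by rewrite -addnA.
have h2 := phi_den_neq0 (d + 2) m; have h4 := phi_den_neq0 (d + 4) m.
have := congr1 (fun k => k%:R : R) (phi_den_shift2 (d + 2) m).
rewrite /phi_coef !phi_den_shift e4 -!mul2n !natrM !natrD !natrM exprS.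
have hm : 1 + m%:R != 0 :> R by rewrite nat1r.
have hd : d%:R + 2 != 0 :> R by rewrite -natrD pnatr_eq0 addn2.
have hd' : d%:R + 4 != 0 :> R by rewrite -natrD pnatr_eq0 addnS.
rewrite -![m.+1%:R]nat1r.
have hwu : 2 * (1 + m%:R) + (d%:R + 2) != 0 :> R.
  by rewrite gt_eqF// ltr_wpDr ?addr_ge0// mulr_gt0// ltr_wpDr.
move: h2 h4 hm hd hd' hwu.
set u := d%:R; set w := m%:R; set z := (phi_den _ _)%:R; set y := (phi_den _ _)%:R.
move=> h2 h4 hm hd hd' hwu e; clearbody u w z y.
have -> : y = (2 * (1 + w) + (u + 2)) * z / (u + 4) by rewrite -e; field.
by field; rewrite ?hd ?hd' ?hm ?h2 ?hwu.
Qed.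

(** The three-term recurrence of Bessel functions.  Together with
    phi_d' = - s phi_(d+2) / (d+2) it contains the Bessel equation. *)
Lemma phi_three_term d s :
  phi (d + 2) s - phi d s = s ^+ 2 / ((d + 2)%:R * (d + 4)%:R) * phi (d + 4) s.
Proof.
rewrite /phi; set x := s ^+ 2.
have cv e := is_cvg_pseries_phi e x.
have h : pseries (phi_coef (d + 2)) x n - pseries (phi_coef d) x n @[n --> \oo] -->
    limn (pseries (phi_coef (d + 2)) x) - limn (pseries (phi_coef d) x).
  by apply: cvgB; exact: cv.
rewrite -(cvg_lim _ h)//; apply/cvg_lim => //.
rewrite -(cvg_shiftS _) /=.
have h' : x / ((d + 2)%:R * (d + 4)%:R) * pseries (phi_coef (d + 4)) x n
    @[n --> \oo] -->
    x / ((d + 2)%:R * (d + 4)%:R) * limn (pseries (phi_coef (d + 4)) x).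
  by apply: cvgMr; exact: cv.
apply: cvg_trans h'; apply: near_eq_cvg; near=> n.
rewrite /=/pseries/series/= -sumrB big_nat_recl//= !expr0 !mulr1.
rewrite [X in X - _](_ : _ = 1) ?[X in _ - X](_ : _ = 1); last 2 first.
- by rewrite /phi_coef /phi_den big_ord0 expr0 divr1.
- by rewrite /phi_coef /phi_den big_ord0 expr0 divr1.
rewrite subrr add0r [LHS]mulr_sumr; apply: eq_bigr => i _.
by rewrite -mulrBl phi_coef_three_term exprS; ring.
Unshelve. all: by end_near. Qed.

Lemma phi0 d : phi d 0 = 1.
Proof.
apply/cvg_lim => //; rewrite -(cvg_shiftS _) /=.
apply: cvg_near_cst; near=> n.
rewrite /pseries/series/= big_nat_recl//= expr0n/= expr0 mulr1.
rewrite /phi_coef {1}/phi_den big_ord0 expr0 divr1 big1 ?addr0// => i _.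
by rewrite !expr0n mulr0.
Unshelve. all: by end_near. Qed.

End bessel_series.

(** * Derivation rules and limits at infinity *)

Section derivation_rules.
Context {R : realType}.
Implicit Types (f g : R -> R) (x : R).

(** The rules below restate the derivation rules for eta-expanded functions and
    with products in place of scalings, so that unification alone can select
    them. *)
Lemma is_derive_mul f g x df dg :
  is_derive x (1 : R) f df -> is_derive x (1 : R) g dg ->
  is_derive x (1 : R) (fun y => f y * g y) (df * g x + f x * dg).
Proof.
move=> hf hg; have := is_deriveM hf hg => h; apply: is_derive_eq.
by rewrite /GRing.scale/= addrC [g x * _]mulrC.
Qed.

Lemma is_derive_add f g x df dg :
  is_derive x (1 : R) f df -> is_derive x (1 : R) g dg ->
  is_derive x (1 : R) (fun y => f y + g y) (df + dg).
Proof. by move=> hf hg; exact: is_deriveD. Qed.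

Lemma is_derive_sub f g x df dg :
  is_derive x (1 : R) f df -> is_derive x (1 : R) g dg ->
  is_derive x (1 : R) (fun y => f y - g y) (df - dg).
Proof. by move=> hf hg; exact: is_deriveB. Qed.

Lemma is_derive_opp f x df :
  is_derive x (1 : R) f df -> is_derive x (1 : R) (fun y => - f y) (- df).
Proof. by move=> hf; exact: is_deriveN. Qed.

Lemma is_derive_const (k x : R) : is_derive x (1 : R) (fun=> k) 0.
Proof. exact: is_derive_cst. Qed.

Lemma is_derive_ident x : is_derive x (1 : R) (fun y => y) 1.
Proof. exact: is_derive_id. Qed.

Lemma is_derive_pow n x :
  is_derive x (1 : R) (fun y => y ^+ n) (n%:R * x ^+ n.-1).
Proof.
apply: DeriveDef; first exact: exprn_derivable.
by rewrite exp_derive /GRing.scale/= mulr1.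
Qed.

Lemma is_derive_powf f n x df : is_derive x (1 : R) f df ->
  is_derive x (1 : R) (fun y => f y ^+ n) (n%:R * f x ^+ n.-1 * df).
Proof.
move=> h; have hn := is_derive_pow n (f x).
exact: (is_derive1_comp hn h).
Qed.

Lemma is_derive_chain f g x df dg :
  is_derive (g x) (1 : R) f df -> is_derive x (1 : R) g dg ->
  is_derive x (1 : R) (fun y => f (g y)) (df * dg).
Proof. exact: is_derive1_comp. Qed.

Lemma is_derive_continuous f x df : is_derive x (1 : R) f df -> {for x, continuous f}.
Proof.
by move=> [h _]; apply: differentiable_continuous; apply/derivable1_diffP.
Qed.

(** The derivative is required only in the open interval: the antiderivatives
    used below are built from expressions that are singular at 0. *)
Lemma le_of_derive_ge0 f f' x y : x <= y ->
  (forall z, x < z -> z < y -> is_derive z (1 : R) f (f' z)) ->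
  (forall z, x <= z -> {for z, continuous f}) ->
  (forall z, x < z -> z < y -> 0 <= f' z) -> f x <= f y.
Proof.
move=> + df cf f0; rewrite le_eqVlt => /predU1P[->//|xy].
have [||c] := @MVT R f f' x y xy.
- by move=> z; rewrite in_itv/= => /andP[xz zy]; exact: df.
- apply: continuous_in_subspaceT => z; rewrite inE/= in_itv/= => /andP[xz _].
  exact: cf.
rewrite in_itv/= => /andP[xc cy] e.
by rewrite -subr_ge0 e mulr_ge0 ?subr_ge0 ?(ltW xy)// f0.
Qed.

End derivation_rules.

Section limits.
Context {R : realType}.

Lemma cvg_div_pinfty (K : R) : K / s @[s --> +oo] --> (0 : R).
Proof.
rewrite -[0](mulr0 K); apply: cvgMr.
apply/(@gtr0_cvgV0 _ _ _ _ (fun s : R => s)); last exact: cvg_id.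
by near=> s; near: s; apply: nbhs_pinfty_gt; rewrite num_real.
Unshelve. all: by end_near. Qed.

Lemma cvg0_le_div (f : R -> R) (K : R) :
  (forall s, 1 <= s -> `|f s| <= K / s) -> f s @[s --> +oo] --> (0 : R).
Proof.
move=> fK.
apply: (@squeeze_cvgr _ _ _ _ (fun s => - (K / s)) (fun s => K / s)).
- by near=> s; rewrite -ler_norml fK.
- by rewrite -[X in _ --> X]oppr0; apply: cvgN; exact: cvg_div_pinfty.
- exact: cvg_div_pinfty.
Unshelve. all: by end_near. Qed.

End limits.

(** [derive_all] leaves the single goal that the computed derivative is the
    expected one.  Derivatives of the atoms must be in the context. *)
Ltac derive_rule :=
  first [ eassumption
        | eapply is_derive_const
        | eapply is_derive_ident
        | eapply is_derive_pow
        | eapply is_derive_powf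
        | eapply is_derive_mul
        | eapply is_derive_add
        | eapply is_derive_sub
        | eapply is_derive_opp ].
Ltac derive_all := eapply is_derive_eq; [ repeat derive_rule | ].

(** * Convergence of the energy of the Bessel equation *)
Section energy.
Context {R : realType}.
Implicit Types (d : nat) (s : R).

(** The second derivative of phi_d in a form that is regular at s = 0; the
    Bessel equation [ddphi_ode] only gives s phi_d''. *)
Definition ddphi d s := d.+1%:R / d.+2%:R * phi (d + 2) s - phi d s.

Lemma is_derive_dphi d s : is_derive s (1 : R) (dphi d) (ddphi d s).
Proof.
have h := is_derive_phi (d + 2) s.
rewrite /dphi /ddphi; derive_all => /=; rewrite /dphi.
have e4 : (d + 2 + 2 = d + 4)%N by rewrite -addnA.
have -> : phi d s =
    phi (d + 2) s - s ^+ 2 / ((d + 2)%:R * (d + 4)%:R) * phi (d + 4) s.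
  by rewrite -phi_three_term; ring.
rewrite e4 mul1r mulr0 addr0.
have -> : d.+1%:R / d.+2%:R = 1 - (d + 2)%:R^-1 :> R.
  have : d.+2%:R != 0 :> R by rewrite pnatr_eq0.
  have -> : d.+1%:R = d.+2%:R - 1 :> R by rewrite -[d.+2%:R]nat1r addrC addKr.
  by rewrite addn2; set u := d.+2%:R => u0; clearbody u; field.
have h1 : (d + 2)%:R != 0 :> R by rewrite pnatr_eq0 addn2.
have h2 : (d + 4)%:R != 0 :> R by rewrite pnatr_eq0 addnS.
move: h1 h2; set u := (d + 2)%:R; set w := (d + 4)%:R => h1 h2; clearbody u w.
by field; rewrite h1 h2.
Qed.

Lemma ddphi_ode d s : s * ddphi d s = - (d.+1%:R * dphi d s) - s * phi d s.
Proof.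
have : d.+2%:R != 0 :> R by rewrite pnatr_eq0.
rewrite /ddphi /dphi addn2; set u := d.+2%:R => u0; clearbody u.
by field.
Qed.

Lemma dphi0 d : dphi d 0 = 0 :> R.
Proof. by rewrite /dphi mul0r oppr0 mul0r. Qed.

Definition energy d s := s ^+ d.+1 * (phi d s ^+ 2 + dphi d s ^+ 2).

Definition osc d s := s ^+ d.+1 * (phi d s ^+ 2 - dphi d s ^+ 2).

(** An antiderivative of [osc], see [is_derive_osc_prim].  It is dominated by the
    energy, hence bounded: this is why [osc] disappears in averages. *)
Definition osc_prim d s := - (s ^+ d.+1 * (phi d s * dphi d s)).

Lemma is_derive_osc_prim d s : is_derive s (1 : R) (osc_prim d) (osc d s).
Proof.
have h := is_derive_phi d s; have h' := is_derive_dphi d s.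
rewrite /osc_prim /osc; derive_all => /=.
have key : s ^+ d.+1 * ddphi d s = s ^+ d * (- (d.+1%:R * dphi d s) - s * phi d s).
  by rewrite -ddphi_ode exprSr mulrA.
transitivity (- (d.+1%:R * s ^+ d * (phi d s * dphi d s) +
  s ^+ d.+1 * dphi d s ^+ 2 + phi d s * (s ^+ d.+1 * ddphi d s))); first by ring.
by rewrite key exprS; ring.
Qed.

(** The derivative of the energy is (d+1) s^d (phi_d^2 - phi_d'^2), of the order
    of energy / s, which is not integrable.  It equals, up to a term of the order
    of energy / s^2, minus the derivative of (d+1) s^d phi_d phi_d'; adding this
    correction leaves the smaller term only. *)
Definition energy_corr d s :=
  energy d s + d.+1%:R * (s ^+ d * (phi d s * dphi d s)).

Lemma is_derive_energy_corr d s : 0 < s ->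
  is_derive s (1 : R) (energy_corr d)
    (- (d.+1%:R * (s ^+ d * (phi d s * dphi d s)) / s)).
Proof.
move=> s0; have h := is_derive_phi d s; have h' := is_derive_dphi d s.
have sN0 : s != 0 by rewrite gt_eqF.
have hd : d%:R * s ^+ d.-1 = d%:R * s ^+ d / s.
  by case: (d) => [|n]; rewrite ?mul0r//= exprS; field.
have e : ddphi d s = - (d.+1%:R * dphi d s) / s - phi d s.
  by apply: (mulfI sN0); rewrite ddphi_ode; field.
have h2 : is_derive s (1 : R) (fun y => phi d y ^+ 2)
    (2 * phi d s * dphi d s).
  by derive_all => /=; ring.
have h2' : is_derive s (1 : R) (fun y => dphi d y ^+ 2)
    (2 * dphi d s * ddphi d s).
  by derive_all => /=; ring.
rewrite /energy_corr /energy; derive_all => /=.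
by rewrite hd e [s ^+ d.+1]exprS -[d.+1%:R]nat1r; field.
Qed.

Lemma energy_ge0 d s : 0 <= s -> 0 <= energy d s.
Proof. by move=> s0; rewrite mulr_ge0 ?exprn_ge0// addr_ge0 ?sqr_ge0. Qed.

Lemma norm_mul_le_sqr (x y : R) : `|x * y| <= (x ^+ 2 + y ^+ 2) / 2.
Proof.
rewrite ler_norml; apply/andP; split.
  rewrite -subr_ge0 (_ : _ - _ = (x + y) ^+ 2 / 2) ?divr_ge0 ?sqr_ge0//.
  by field.
rewrite -subr_ge0 (_ : _ - _ = (x - y) ^+ 2 / 2) ?divr_ge0 ?sqr_ge0//.
by field.
Qed.

Lemma energy_corr_error d s : 0 < s ->
  `|d.+1%:R * (s ^+ d * (phi d s * dphi d s))| <= d.+1%:R / (2 * s) * energy d s.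
Proof.
move=> s0; have sN0 : s != 0 by rewrite gt_eqF.
rewrite normrM ger0_norm// -mulrA ler_wpM2l// normrM ger0_norm ?exprn_ge0 ?(ltW s0)//.
have -> : (2 * s)^-1 * energy d s = s ^+ d * ((phi d s ^+ 2 + dphi d s ^+ 2) / 2).
  by rewrite /energy exprS; field.
by rewrite ler_wpM2l ?exprn_ge0 ?(ltW s0)// norm_mul_le_sqr.
Qed.

(** From s = d + 1 on the correction is at most half of the energy. *)
Lemma energy_le_corr d s : d.+1%:R <= s -> energy d s <= 2 * energy_corr d s.
Proof.
move=> ds; have s0 : 0 < s by apply: lt_le_trans ds.
have := energy_corr_error d _ s0; rewrite ler_norml => /andP[+ _].
have : d.+1%:R / (2 * s) * energy d s <= 2^-1 * energy d s.
  apply: ler_wpM2r; first by rewrite energy_ge0// ltW.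
  by rewrite invfM mulrCA ler_piMr// ler_pdivrMr// mul1r.
rewrite /energy_corr; lra.
Qed.

(** The exponential factor absorbs the remaining derivative of [energy_corr], at
    most (d+1) / s^2 times [energy_corr] in absolute value, into a monotone
    function, and it tends to 1 at infinity. *)
Definition energy_damped d s := energy_corr d s * expR (d.+1%:R / s).

Lemma energy_damped_decr d s t : d.+1%:R <= s -> s <= t ->
  energy_damped d t <= energy_damped d s.
Proof.
move=> ds st; rewrite -lerN2.
pose D x := (d.+1%:R * (x ^+ d * (phi d x * dphi d x)) / x
  + d.+1%:R / x ^+ 2 * energy_corr d x) * expR (d.+1%:R / x).
have pos (x : R) : d.+1%:R <= x -> 0 < x by exact: lt_le_trans.
have dL (x : R) : d.+1%:R <= x -> is_derive x (1 : R) (fun x => - energy_damped d x) (D x).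
  move=> /pos x0; have xN0 : x != 0 by rewrite gt_eqF.
  have h := is_derive_energy_corr d x x0.
  have hV : is_derive x (1 : R) (fun y => y^-1) (- x ^- 2).
    have hid := is_derive_ident x.
    apply: DeriveDef; first exact: derivableV.
    by rewrite deriveV// derive_val /GRing.scale/= mulr1.
  have hi : is_derive x (1 : R) (fun y => d.+1%:R / y) (- (d.+1%:R / x ^+ 2)).
    by derive_all => /=; rewrite mul0r add0r mulrN.
  have he := @is_derive_chain R expR (fun y => d.+1%:R / y) x _ _
    (is_derive_expR _) hi.
  rewrite /energy_damped; derive_all => /=.
  by rewrite /D; field.
have cL (x : R) : d.+1%:R <= x -> {for x, continuous (fun x => - energy_damped d x)}.
  by move=> /dL h; exact: is_derive_continuous h.
apply: (@le_of_derive_ge0 R (fun x => - energy_damped d x) D) => //.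
- by move=> x /ltW sx _; apply: dL; exact: le_trans sx.
- by move=> x sx; apply: cL; exact: le_trans sx.
move=> x /ltW sx _; have dx := le_trans ds sx; have x0 := pos _ dx.
rewrite /D mulr_ge0 ?expR_ge0//.
have h1 := energy_corr_error d x x0; have h2 := energy_le_corr _ _ dx.
rewrite -lerBlDr sub0r; move: h1; rewrite ler_norml => /andP[+ _].
set P := _ * (_ * _) => h1.
have : - (d.+1%:R / (2 * x) * (2 * energy_corr d x)) <= P.
  by apply: le_trans h1; rewrite lerN2 ler_wpM2l// divr_ge0// mulr_ge0// ltW.
move=> h; rewrite ler_pdivlMr//; apply: le_trans h.
rewrite -subr_ge0 [leRHS](_ : _ = 0)//; field.
by rewrite gt_eqF.
Qed.

Lemma energy_corr_ge0 d s : d.+1%:R <= s -> 0 <= energy_corr d s.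
Proof.
move=> ds; have s0 : 0 <= s by apply: le_trans ds.
by have := energy_le_corr _ _ ds; have := energy_ge0 d _ s0; lra.
Qed.

Lemma energy_bounded_aux d : exists C, forall s, d.+1%:R <= s -> energy d s <= C.
Proof.
exists (2 * energy_damped d d.+1%:R) => s ds.
apply: (le_trans (energy_le_corr _ _ ds)); rewrite ler_pM2l//.
apply: le_trans (energy_damped_decr _ _ _ (lexx _) ds).
rewrite /energy_damped ler_peMr ?energy_corr_ge0// -[leLHS]expR0 ler_expR.
by rewrite divr_ge0// (le_trans _ ds).
Qed.

Lemma continuous_energy d : continuous (energy d).
Proof.
move=> s; have h := is_derive_phi d s; have h' := is_derive_dphi d s.
suff [df hd] : exists df, is_derive s (1 : R) (energy d) df.
  exact: is_derive_continuous hd.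
eexists; rewrite /energy; repeat derive_rule.
Qed.

Lemma energy_bounded d : exists C, forall s, 0 <= s -> energy d s <= C.
Proof.
have [C hC] := energy_bounded_aux d.
have [c _ hc] := @EVT_max R (energy d) 0 d.+1%:R (ler0n _ _)
  (continuous_subspaceT (@continuous_energy d)).
exists (Num.max C (energy d c)) => s s0; rewrite le_max.
have [/hC->//|/ltW sd] := leP d.+1%:R s.
by rewrite hc ?orbT// in_itv/= s0.
Qed.

(** The damped corrected energy is eventually nonincreasing and nonnegative, so
    it converges; damping factor and correction are asymptotically negligible. *)
Lemma energy_cvg d : exists2 E : R, 0 <= E & energy d s @[s --> +oo] --> E.
Proof.
pose k : R := d.+1%:R.
(* Monotonicity is only known from s = d + 1 on, hence the maximum. *)
pose f s := - energy_damped d (Num.max s k).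
have lyap0 (s : R) : k <= s -> 0 <= energy_damped d s.
  by move=> ks; rewrite mulr_ge0 ?expR_ge0 ?energy_corr_ge0.
have f_nd : nondecreasing_fun f.
  move=> s t st; rewrite lerN2; apply: energy_damped_decr.
    by rewrite le_max lexx orbT.
  by rewrite ge_max !le_max st lexx orbT.
have f_ub : has_ubound (range f).
  exists 0 => _ [s _ <-]; rewrite oppr_le0; apply: lyap0.
  by rewrite le_max lexx orbT.
have := nondecreasing_cvgr f_nd f_ub; set M := sup _ => /cvgN fM.
have lyapM : energy_damped d s @[s --> +oo] --> - M.
  apply: cvg_trans fM; apply: near_eq_cvg; near=> s.
  rewrite -[LHS]/(- f s) /f opprK max_l//.
exists (- M).
  apply: (@cvgr_to_ge _ _ _ _ _ _ _ lyapM).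
  by near=> s; apply: lyap0.
have e1 : energy_damped d s * expR (- (k / s)) @[s --> +oo] --> - M.
  rewrite -[X in _ --> X]mulr1; apply: cvgM; first exact: lyapM.
  have e0 : - (k / s) @[s --> +oo] --> - (0 : R) by apply: cvgN; exact: cvg_div_pinfty.
  rewrite -expR0 -[X in expR X]oppr0.
  apply: (@continuous_cvg _ _ _ _ _ (fun x : R => - (k / x)) expR (- 0)).
    exact: continuous_expR.
  exact: e0.
have [C hC] := energy_bounded d.
have e2 : k * (s ^+ d * (phi d s * dphi d s)) @[s --> +oo] --> (0 : R).
  apply: (@cvg0_le_div _ _ (k / 2 * C)) => s s1.
  have s0 : 0 < s by apply: lt_le_trans s1.
  apply: (le_trans (energy_corr_error _ _ s0)).
  rewrite (_ : k / 2 * C / s = k / (2 * s) * C); last by field; rewrite gt_eqF.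
  by rewrite ler_wpM2l ?hC ?(ltW s0)// divr_ge0// mulr_ge0// ltW.
have e3 : energy_damped d s * expR (- (k / s)) -
    k * (s ^+ d * (phi d s * dphi d s)) @[s --> +oo] --> - M - 0.
  by apply: cvgB.
rewrite subr0 in e3; apply: cvg_trans e3; apply: near_eq_cvg; near=> s.
rewrite /energy_damped -mulrA -expRD subrr expR0 mulr1.
by rewrite /energy_corr addrK.
Unshelve. all: by end_near. Qed.

End energy.

(** * The limit energy: steps of two in the dimension, and the sine case *)

Section energy_limit.
Context {R : realType}.
Implicit Types (d : nat) (s : R).

Definition energy_lim d : R := lim (energy d s @[s --> (+oo : set_system R)]).

Lemma energy_lim_unique d (E : R) :
  energy d s @[s --> (+oo : set_system R)] --> E -> energy_lim d = E.
Proof. by move=> h; apply/cvg_lim. Qed.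

Lemma cvg_energy d : energy d s @[s --> (+oo : set_system R)] --> energy_lim d.
Proof. by have [E _ h] := @energy_cvg R d; rewrite (energy_lim_unique _ _ h). Qed.

(** Every quadratic expression in phi_d and phi_d' is of the order of
    s^-(d+1), by boundedness of the energy.  The uniform shape lets one lemma
    serve for all boundary terms. *)
Lemma cvg_quad0 d j (c1 c2 c3 : R) : (j <= d)%N ->
  s ^+ j * (c1 * phi d s ^+ 2 + c2 * (phi d s * dphi d s) + c3 * dphi d s ^+ 2)
    @[s --> +oo] --> (0 : R).
Proof.
move=> jd; have [C hC] := @energy_bounded R d.
set M := `|c1| + `|c2| + `|c3|.
apply: (@cvg0_le_div _ _ (M * C)) => s s1.
have s0 : 0 < s by apply: lt_le_trans s1.
set a := phi d s; set b := dphi d s.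
have hM : `|c1 * a ^+ 2 + c2 * (a * b) + c3 * b ^+ 2| <= M * (a ^+ 2 + b ^+ 2).
  have h2 := norm_mul_le_sqr a b.
  apply: (le_trans (ler_normD _ _)).
  apply: (le_trans (lerD (ler_normD _ _) (lexx _))).
  rewrite (normrM c1) (normrM c2) (normrM c3) !(ger0_norm (sqr_ge0 _)) /M !mulrDl.
  apply: lerD; first apply: lerD; apply: ler_wpM2l => //.
  - by rewrite lerDl sqr_ge0.
  - by apply: (le_trans h2); rewrite ler_piMr ?addr_ge0 ?sqr_ge0// invf_le1// ler1n.
  - by rewrite lerDr sqr_ge0.
rewrite normrM (ger0_norm (exprn_ge0 _ (ltW s0))).
have e := hC _ (ltW s0).
apply: (@le_trans _ _ (s ^+ d * (M * (a ^+ 2 + b ^+ 2)))).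
  apply: ler_pM => //; first by rewrite exprn_ge0// ltW.
  by rewrite ler_weXn2l.
rewrite ler_pdivlMr// mulrAC -exprSr mulrCA ler_wpM2l//.
by rewrite /M !addr_ge0.
Qed.

Lemma mul_phi_add2 d s : s * phi (d + 2) s = - ((d + 2)%:R * dphi d s).
Proof.
have : (d + 2)%:R != 0 :> R by rewrite pnatr_eq0 addn2.
by rewrite /dphi; set u := (d + 2)%:R => u0; clearbody u; field.
Qed.

Lemma mul_dphi_add2 d s : s * dphi (d + 2) s = (d + 2)%:R * (phi d s - phi (d + 2) s).
Proof.
rewrite -opprB phi_three_term /dphi -addnA.
have h1 : (d + 2)%:R != 0 :> R by rewrite pnatr_eq0 addn2.
have h2 : (d + 4)%:R != 0 :> R by rewrite pnatr_eq0 addnS.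
move: h1 h2; set u := (d + 2)%:R; set w := (d + 4)%:R => h1 h2; clearbody u w.
by field; rewrite h1 h2.
Qed.

Lemma energy_add2 d s : s != 0 ->
  energy (d + 2) s = (d + 2)%:R ^+ 2 * (energy d s +
    (2 * (d + 2)%:R) * (s ^+ d * (0 * phi d s ^+ 2 + 1 * (phi d s * dphi d s) + 0 * dphi d s ^+ 2)))
    + (d + 2)%:R ^+ 2 *
      (s ^+ d.+1 * (1 * phi (d + 2) s ^+ 2 + 0 * (phi (d + 2) s * dphi (d + 2) s) + 0 * dphi (d + 2) s ^+ 2)).
Proof.
move=> s0; rewrite /energy (_ : (d + 2).+1 = d + 1 + 2)%N; last by rewrite addnAC addn1.
have -> : s ^+ (d + 1 + 2) * (phi (d + 2) s ^+ 2 + dphi (d + 2) s ^+ 2) =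
  s ^+ (d + 1) * ((s * phi (d + 2) s) ^+ 2 + (s * dphi (d + 2) s) ^+ 2).
  by rewrite exprD; ring.
rewrite mul_dphi_add2 mul_phi_add2 addn1.
have -> : phi (d + 2) s = - ((d + 2)%:R * dphi d s) / s.
  by apply: (mulfI s0); rewrite mul_phi_add2; field.
by rewrite exprSr; field.
Qed.

(** The contiguity relations express phi_(d+2) and phi_(d+2)' through phi_d' / s
    and phi_d / s, up to terms of lower order. *)
Lemma energy_lim_add2 d : energy_lim (d + 2) = (d + 2)%:R ^+ 2 * energy_lim d.
Proof.
apply: energy_lim_unique.
have e1 := @cvg_quad0 d d 0 1 0 (leqnn _).
have e2 := @cvg_quad0 (d + 2) d.+1 1 0 0 (ltac:(by rewrite addn2)).
set U := (d + 2)%:R.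
have h : U ^+ 2 * (energy d s +
    (2 * U) * (s ^+ d * (0 * phi d s ^+ 2 + 1 * (phi d s * dphi d s) + 0 * dphi d s ^+ 2)))
    + U ^+ 2 *
      (s ^+ d.+1 * (1 * phi (d + 2) s ^+ 2 + 0 * (phi (d + 2) s * dphi (d + 2) s) + 0 * dphi (d + 2) s ^+ 2))
   @[s --> +oo] --> U ^+ 2 * (energy_lim d + 2 * U * 0) + U ^+ 2 * 0.
  apply: cvgD; last by apply: cvgMr; exact: e2.
  apply: cvgMr; apply: cvgD; first exact: cvg_energy.
  by apply: cvgMr; exact: e1.
move: h; rewrite !mulr0 !addr0; apply: cvg_trans; apply: near_eq_cvg; near=> s.
rewrite energy_add2// gt_eqF//.
Unshelve. all: by end_near. Qed.

Lemma phi_den1 m : phi_den 1 m = (m.*2.+1)`!.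
Proof.
elim: m => [|m IH]; first by rewrite /phi_den big_ord0.
by rewrite phi_denS IH doubleS addn1 !factS; ring.
Qed.

Lemma mul_phi1 s : s * phi 1 s = sin s.
Proof.
have hs := @cvg_sin_coeff' R s.
rewrite -(cvg_lim _ hs)//; apply/esym/cvg_lim => //.
have h : s * pseries (phi_coef 1) (s ^+ 2) n @[n --> \oo] --> s * phi 1 s.
  by apply: cvgMr; exact: is_cvg_pseries_phi.
apply: cvg_trans h; apply: near_eq_cvg; near=> n.
rewrite /pseries/series/= mulr_sumr; apply: eq_bigr => i _.
by rewrite /sin_coeff' /phi_coef phi_den1 -exprM mul2n exprS -exprnP; ring.
Unshelve. all: by end_near. Qed.

Lemma phi1_add_mul_dphi1 s : phi 1 s + s * dphi 1 s = cos s.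
Proof.
have h := is_derive_phi 1 s.
have h1 : is_derive s (1 : R) (fun y => y * phi 1 y) (phi 1 s + s * dphi 1 s).
  by derive_all => /=; rewrite mul1r.
have h2 : is_derive s (1 : R) (fun y => y * phi 1 y) (cos s).
  have -> : (fun y : R => y * phi 1 y) = @sin R by apply/funext => y; exact: mul_phi1.
  exact: is_derive_sin.
by rewrite -(@derive_val _ _ _ _ _ _ _ h1) (@derive_val _ _ _ _ _ _ _ h2).
Qed.

(** Here phi_1(s) = sin s / s, so the energy is sin^2 + cos^2 up to O(1/s). *)
Lemma energy_lim1 : energy_lim 1 = 1.
Proof.
apply: energy_lim_unique.
suff h : energy 1 s - 1 @[s --> +oo] --> (0 : R).
  have h2 : energy 1 s - 1 + 1 @[s --> +oo] --> (0 + 1 : R).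
    by apply: cvgD; [exact: h|exact: cvg_cst].
  move: h2; rewrite add0r; under eq_fun do rewrite subrK.
  exact.
apply: (@cvg0_le_div _ _ 3) => s s1.
have s0 : 0 < s by apply: lt_le_trans s1.
have e1 : sin s = s * phi 1 s by rewrite mul_phi1.
have e2 : s * dphi 1 s = cos s - phi 1 s by rewrite -phi1_add_mul_dphi1; ring.
have -> : energy 1 s - 1 = phi 1 s * (phi 1 s - 2 * cos s).
  have -> : energy 1 s = (s * phi 1 s) ^+ 2 + (s * dphi 1 s) ^+ 2.
    by rewrite /energy; ring.
  have e3 : sin s ^+ 2 = 1 - cos s ^+ 2 by rewrite -(cos2Dsin2 s); ring.
  by rewrite -e1 e2 e3; ring.
have hp : `|phi 1 s| <= s^-1.
  rewrite -[leRHS]mul1r ler_pdivlMr// -{2}(ger0_norm (ltW s0)) -normrM mulrC mul_phi1.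
  by rewrite ler_norml sin_geN1 sin_le1.
have hc : `|cos s| <= 1 by rewrite ler_norml cos_geN1 cos_le1.
rewrite normrM mulrC ler_pM//.
apply: (le_trans (ler_normB _ _)); rewrite normrM (@ger0_norm _ 2)//.
have : s^-1 <= 1 by rewrite invf_le1.
lra.
Qed.

End energy_limit.

(** * Moments of squared Bessel functions *)

Section moments.
Context {R : realType}.
Implicit Types (d k m l : nat) (s B : R).

(** The improper integral of s^k phi_d^2 over the half line is B.  Stating it with
    an antiderivative avoids integrals: linearity is a derivation rule and
    monotonicity is the mean value theorem. *)
Definition has_moment d k B := exists T : R -> R,
  [/\ forall s, 0 < s -> is_derive s (1 : R) T (s ^+ k * phi d s ^+ 2),
      forall s, {for s, continuous T}, T 0 = 0 & T s @[s --> +oo] --> B].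

Lemma is_derive_phi_sqr d s :
  is_derive s (1 : R) (fun y => phi d y ^+ 2) (2 * phi d s * dphi d s).
Proof.
have h := is_derive_phi d s.
by derive_all => /=; ring.
Qed.

Lemma is_derive_dphi_sqr d s : s != 0 ->
  is_derive s (1 : R) (fun y => dphi d y ^+ 2)
    (2 * dphi d s * (- (d.+1%:R * dphi d s) / s - phi d s)).
Proof.
move=> s0; have h' := is_derive_dphi d s.
have <- : ddphi d s = - (d.+1%:R * dphi d s) / s - phi d s.
  by apply: (mulfI s0); rewrite ddphi_ode; field.
by derive_all => /=; ring.
Qed.

Lemma is_derive_phi_dphi d s : s != 0 ->
  is_derive s (1 : R) (fun y => phi d y * dphi d y)
    (dphi d s ^+ 2 + phi d s * (- (d.+1%:R * dphi d s) / s - phi d s)).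
Proof.
move=> s0; have h := is_derive_phi d s; have h' := is_derive_dphi d s.
have <- : ddphi d s = - (d.+1%:R * dphi d s) / s - phi d s.
  by apply: (mulfI s0); rewrite ddphi_ode; field.
by derive_all => /=; ring.
Qed.

Lemma continuous_quad d j (c1 c2 c3 : R) s :
  {for s, continuous (fun s =>
  s ^+ j * (c1 * phi d s ^+ 2 + c2 * (phi d s * dphi d s) + c3 * dphi d s ^+ 2))}.
Proof.
have h := is_derive_phi d s; have h' := is_derive_dphi d s.
eapply is_derive_continuous; repeat derive_rule.
Qed.

(** By the Bessel equation, for d = m + 2 + l the derivative of this expression
    involves only s^(m+2) phi_d^2 and s^m phi_d^2: the coefficients of the three
    terms are those that cancel the contributions of phi_d phi_d' and phi_d'^2.
    This relates the moments of orders m + 2 and m. *)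
Definition moment_boundary d m (l : nat) s : R :=
  s ^+ m.+3 * (1 * phi d s ^+ 2 + 0 * (phi d s * dphi d s) + 1 * dphi d s ^+ 2) +
  s ^+ m.+2 * (0 * phi d s ^+ 2 + (d.+1 + l)%:R * (phi d s * dphi d s) + 0 * dphi d s ^+ 2) +
  s ^+ m.+1 * (((d.+1 + l) * l.+1)%:R / 2 * phi d s ^+ 2 + 0 * (phi d s * dphi d s) + 0 * dphi d s ^+ 2).

Lemma is_derive_moment_boundary d m l s : 0 < s -> (d = m + 2 + l)%N ->
  is_derive s (1 : R) (moment_boundary d m l)
   (- (l.*2%:R * (s ^+ m.+2 * phi d s ^+ 2)) +
    ((d.+1 + l) * l.+1 * m.+1)%:R / 2 * (s ^+ m * phi d s ^+ 2)).
Proof.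
move=> s0 dE; have sN0 : s != 0 by rewrite gt_eqF.
have h1 := is_derive_phi_sqr d s; have h2 := is_derive_dphi_sqr d s sN0.
have h3 := is_derive_phi_dphi d s sN0.
rewrite /moment_boundary; derive_all => /=.
have -> : d.+1%:R = m%:R + 3 + l%:R :> R.
  by rewrite dE -addn1 !natrD; ring.
have -> : (d.+1 + l)%:R = m%:R + 3 + l%:R * 2 :> R.
  by rewrite dE -addn1 !natrD; ring.
have -> : ((d.+1 + l) * l.+1)%:R = (m%:R + 3 + l%:R * 2) * (l%:R + 1) :> R.
  by rewrite dE -addn1 natrM !natrD; ring.
have -> : ((d.+1 + l) * l.+1 * m.+1)%:R =
    (m%:R + 3 + l%:R * 2) * (l%:R + 1) * (m%:R + 1) :> R.
  by rewrite dE -addn1 !natrM !natrD; ring.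
have -> : l.*2%:R = 2 * l%:R :> R by rewrite -mul2n natrM.
rewrite -[m.+3%:R]nat1r -[m.+2%:R]nat1r -[m.+1%:R]nat1r !exprS.
by field.
Qed.

Lemma moment_boundary0 d m l : moment_boundary d m l 0 = 0.
Proof. by rewrite /moment_boundary !expr0n/= !mul0r !addr0. Qed.

Lemma continuous_moment_boundary d m l s : {for s, continuous (moment_boundary d m l)}.
Proof.
by apply: cvgD; [apply: cvgD|]; exact: continuous_quad.
Qed.

(** Only the first term can survive at infinity, and it does exactly for l = 0,
    when it is the energy. *)
Lemma cvg_moment_boundary d m l : (d = m + 2 + l)%N ->
  moment_boundary d m l s @[s --> +oo] --> (if l == 0 then energy_lim d else 0 : R).
Proof.
move=> dE.
rewrite -[X in _ --> X](addr0) -[X in _ --> X + _](addr0).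
apply: cvgD; [apply: cvgD|]; last 2 first.
- by apply: cvg_quad0; rewrite dE addn2 leq_addr.
- by apply: cvg_quad0; rewrite dE addn2 addSn (leq_trans (leqnSn _))// ltnS leq_addr.
case: eqP => [l0|l0]; last first.
  by apply: cvg_quad0; rewrite dE addn2 -addn1 leq_add2l lt0n; exact/eqP.
have -> : m.+3 = d.+1 by rewrite dE l0 addn0 addn2.
by under eq_fun do rewrite mul0r addr0 !mul1r; exact: cvg_energy.
Qed.

Lemma has_moment_step d m l B : (d = m + 2 + l)%N -> (0 < l)%N ->
  has_moment d m.+2 B ->
  has_moment d m (4 * l%:R * B / ((d.+1 + l) * l.+1 * m.+1)%:R).
Proof.
move=> dE l0 [T [dT cT T0 TB]].
set q : R := ((d.+1 + l) * l.+1 * m.+1)%:R.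
have q0 : q != 0 by rewrite pnatr_eq0 !muln_eq0.
exists (fun s => 2 / q * (moment_boundary d m l s + l.*2%:R * T s)); split.
- move=> s s0; have h1 := dT _ s0; have h2 := is_derive_moment_boundary d m l s s0 dE.
  derive_all => /=.
  by rewrite -/q; clearbody q; set w := l.*2%:R; clearbody w; field.
- move=> s; apply: cvgMr; apply: cvgD; first exact: continuous_moment_boundary.
  by apply: cvgMr; exact: cT.
- by rewrite moment_boundary0 T0 !(mulr0, addr0).
- have -> : 4 * l%:R * B / q = 2 / q * (0 + l.*2%:R * B).
    by rewrite -mul2n natrM; clearbody q; field.
  apply: cvgMr; apply: cvgD; last by apply: cvgMr.
  by have := @cvg_moment_boundary d m l dE; rewrite eqn0Ngt l0.
Qed.

(** The case l = 0: the moment of order m + 2 drops out of the relation and the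
    boundary term brings in the limit energy. *)
Lemma has_moment_two m :
  has_moment (m + 2) m (2 * energy_lim (m + 2) / (m.+3 * m.+1)%:R).
Proof.
have dE : (m + 2 = m + 2 + 0)%N by rewrite addn0.
set d := (m + 2)%N in dE *.
have dE1 : d.+1 = m.+3 by rewrite /d addn2.
set q : R := (m.+3 * m.+1)%:R.
have q0 : q != 0 by rewrite pnatr_eq0 muln_eq0.
exists (fun s => 2 / q * moment_boundary d m 0 s); split.
- move=> s s0; have h2 := is_derive_moment_boundary d m 0 s s0 dE.
  derive_all => /=.
  by rewrite addn0 muln1 dE1 -/q double0; clearbody q; field.
- by move=> s; apply: cvgMr; exact: continuous_moment_boundary.
- by rewrite moment_boundary0 mulr0.
- rewrite mulrAC; apply: cvgMr; exact: (@cvg_moment_boundary d m 0 dE).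
Qed.

(** The moments of order d - 1 follow from phi_(d+2) = - (d+2) phi_d' / s and
    (s^d (phi_d^2 + phi_d'^2))' = d s^(d-1) phi_d^2 - (d+2) s^(d-1) phi_d'^2, by
    induction on even d.  For d = 0 the boundary value at s = 0 is the
    source: it is why these moments are rational and do not see the limit
    energy. *)
Lemma has_moment_one_base : has_moment 2 1 2.
Proof.
exists (fun s => 2 * (1 - s ^+ 0 * (1 * phi 0 s ^+ 2 + 0 * (phi 0 s * dphi 0 s) + 1 * dphi 0 s ^+ 2))); split.
- move=> s s0; have sN0 : s != 0 by rewrite gt_eqF.
  have h1 := is_derive_phi_sqr 0 s; have h2 := is_derive_dphi_sqr 0 s sN0.
  have h3 := is_derive_phi_dphi 0 s sN0.
  derive_all => /=.
  have -> : phi 2 s = - (2 * dphi 0 s) / s.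
    by apply: (mulfI sN0); rewrite (mul_phi_add2 0); field.
  by rewrite expr0; field.
- move=> s; apply: cvgMr; apply: cvgB; first exact: cvg_cst.
  exact: continuous_quad.
- by rewrite phi0 dphi0 expr0; ring.
- have e : 2 = 2 * (1 - 0) :> R by ring.
  rewrite [X in _ --> X]e; apply: cvgMr.
  by apply: cvgB; [exact: cvg_cst|exact: cvg_quad0].
Qed.

Lemma has_moment_one_step d B : has_moment d.+1 d B ->
  has_moment d.+3 d.+2 (d.+3%:R * d.+1%:R * B).
Proof.
move=> [T [dT cT T0 TB]].
exists (fun s => d.+3%:R * (d.+1%:R * T s - s ^+ d.+1 * (1 * phi d.+1 s ^+ 2 +
  0 * (phi d.+1 s * dphi d.+1 s) + 1 * dphi d.+1 s ^+ 2))); split.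
- move=> s s0; have sN0 : s != 0 by rewrite gt_eqF.
  have h := dT _ s0.
  have h1 := is_derive_phi_sqr d.+1 s; have h2 := is_derive_dphi_sqr d.+1 s sN0.
  have h3 := is_derive_phi_dphi d.+1 s sN0.
  derive_all => /=.
  have -> : phi d.+3 s = - (d.+3%:R * dphi d.+1 s) / s.
    apply: (mulfI sN0); have := mul_phi_add2 d.+1 s; rewrite addn2 => ->.
    by field.
  rewrite -[d.+3%:R]nat1r -[d.+2%:R]nat1r -[d.+1%:R]nat1r !exprS.
  by field.
- move=> s; apply: cvgMr; apply: cvgB; last exact: continuous_quad.
  by apply: cvgMr; exact: cT.
- by rewrite T0 expr0n/= mulr0 mul0r subr0 mulr0.
- have -> : d.+3%:R * d.+1%:R * B = d.+3%:R * (d.+1%:R * B - 0) :> R by ring.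
  apply: cvgMr.
  by apply: cvgB; [exact: cvgMr|exact: cvg_quad0].
Qed.

(** The Cauchy-Schwarz inequality as the positivity of the integral of
    s^l (x s - 1)^2 phi_d^2. *)
Lemma has_moment_quad_ge0 d l B0 B1 B2 (x : R) :
  has_moment d l.+2 B0 -> has_moment d l.+1 B1 -> has_moment d l B2 ->
  0 <= x ^+ 2 * B0 - 2 * x * B1 + B2.
Proof.
move=> [T0 [d0 c0 T00 TB0]] [T1 [d1 c1 T10 TB1]] [T2 [d2 c2 T20 TB2]].
pose F s := x ^+ 2 * T0 s - 2 * x * T1 s + T2 s.
have FB : F s @[s --> +oo] --> x ^+ 2 * B0 - 2 * x * B1 + B2.
  apply: cvgD; last exact: TB2.
  by apply: cvgB; apply: cvgMr; [exact: TB0|exact: TB1].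
apply: (@cvgr_to_ge _ _ _ _ _ _ _ FB); near=> s.
have -> : 0 = F 0 by rewrite /F T00 T10 T20; ring.
have s0 : 0 <= s by near: s; apply: nbhs_pinfty_ge; rewrite num_real.
apply: (le_of_derive_ge0 F (fun s => s ^+ l * phi d s ^+ 2 * (x * s - 1) ^+ 2) _ _ s0).
- move=> z z0 _; have h0 := d0 _ z0; have h1 := d1 _ z0; have h2 := d2 _ z0.
  by rewrite /F; derive_all => /=; rewrite !exprS; ring.
- move=> z _; apply: cvgD; last exact: c2.
  by apply: cvgB; apply: cvgMr; [exact: c0|exact: c1].
- by move=> z z0 _; rewrite mulr_ge0 ?sqr_ge0// mulr_ge0 ?sqr_ge0// exprn_ge0// ltW.
Unshelve. all: by end_near. Qed.

End moments.

(** * The limit energy in dimension zero *)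

Section wallis.
Context {R : realType}.
Implicit Types (j : nat).

(** The integral of sin^j over [0, pi/2], by its recursion. *)
Fixpoint wallis j : R :=
  match j with
  | 0 => pi / 2
  | 1 => 1
  | j'.+2 => j'.+1%:R / j'.+2%:R * wallis j'
  end.

Lemma wallis_antiderivative j : exists T : R -> R,
  (forall x, is_derive x (1 : R) T (sin x ^+ j)) /\ T (pi / 2) - T 0 = wallis j.
Proof.
suff : (exists T : R -> R,
  (forall x, is_derive x (1 : R) T (sin x ^+ j)) /\ T (pi / 2) - T 0 = wallis j)
  /\ (exists T : R -> R,
  (forall x, is_derive x (1 : R) T (sin x ^+ j.+1)) /\ T (pi / 2) - T 0 = wallis j.+1).
  by case.
elim: j => [|j [[T [dT T0]] hS]].
  split.
    exists (fun x => x); split; last by rewrite subr0.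
    by move=> x; rewrite expr0; exact: is_derive_ident.
  exists (fun x => - cos x); split.
    move=> x; have h := is_derive_cos x.
    by derive_all => /=; rewrite opprK expr1.
  by rewrite cos_pihalf cos0 oppr0 sub0r opprK.
split=> //.
exists (fun x => j.+2%:R^-1 * (j.+1%:R * T x - sin x ^+ j.+1 * cos x)); split.
  move=> x; have h := dT x; have hc := is_derive_cos x; have hs := is_derive_sin x.
  derive_all => /=.
  have -> : sin x ^+ j.+2 = sin x ^+ j * (1 - cos x ^+ 2).
    by rewrite -(cos2Dsin2 x) !exprS; ring.
  have -> : - (j.+1%:R * sin x ^+ j * cos x * cos x + sin x ^+ j.+1 * - sin x) =
    - (j.+1%:R * sin x ^+ j * cos x ^+ 2) + sin x ^+ j * (1 - cos x ^+ 2).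
    by rewrite -(cos2Dsin2 x) !exprS; ring.
  have : j.+2%:R != 0 :> R by rewrite pnatr_eq0.
  have -> : j.+2%:R = 1 + j.+1%:R :> R by rewrite nat1r.
  set w := j.+1%:R => w0; clearbody w; field.
  exact: w0.
rewrite cos_pihalf sin0 expr0n/= mul0r subr0 mulr0 subr0.
by rewrite -mulrBr -mulrBr T0 mulrA [j.+2%:R^-1 * _]mulrC.
Qed.

Lemma wallis_gt0 j : 0 < wallis j.
Proof.
suff : 0 < wallis j /\ 0 < wallis j.+1 by case.
elim: j => [|j [h1 h2]]; first by rewrite /= divr_gt0 ?pi_gt0.
by split => //=; rewrite mulr_gt0// divr_gt0.
Qed.

Lemma wallis_le j : wallis j.+1 <= wallis j.
Proof.
have [T [dT <-]] := wallis_antiderivative j; have [S [dS <-]] := wallis_antiderivative j.+1.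
have p0 : 0 <= pi / 2 :> R by rewrite divr_ge0// pi_ge0.
have h := le_of_derive_ge0 (fun x => T x - S x)
  (fun x => sin x ^+ j - sin x ^+ j.+1) _ _ p0.
suff : T 0 - S 0 <= T (pi / 2) - S (pi / 2) by lra.
have cf (f f' : R -> R) : (forall x : R, is_derive x (1 : R) f (f' x)) -> continuous f.
  by move=> df x; apply: (is_derive_continuous _ _ _ (df x)).
apply: h.
- by move=> z _; apply: cvgB; [exact: (cf _ _ dT)|exact: (cf _ _ dS)].
- move=> z z0 zpi; rewrite subr_ge0 exprS ler_piMl ?sin_le1// exprn_ge0//.
  apply: sin_ge0_pi; rewrite (ltW z0)/=.
  by rewrite (le_trans (ltW zpi))// ler_pdivrMr// ler_peMr// ?pi_ge0// ler1n.
Qed.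

End wallis.

(** A quadratic function that is nonnegative everywhere; a = 0 is allowed, since
    the limits to which this is applied are not known to be positive. *)
Lemma discriminant_le0 {R : realFieldType} (a b c : R) : 0 <= a ->
  (forall x, 0 <= x ^+ 2 * a - 2 * x * b + c) -> b ^+ 2 <= a * c.
Proof.
rewrite le_eqVlt => /predU1P[<- h|a0 h].
  rewrite mul0r; have [->|b0] := eqVneq b 0; first by rewrite expr0n.
  have := h ((c + 1) / (2 * b)); rewrite mulr0 sub0r.
  by rewrite (_ : _ + c = -1) ?ler0N1//; field.
have := h (b / a).
rewrite (_ : _ + c = (a * c - b ^+ 2) / a); last by field; rewrite gt_eqF.
by rewrite pmulr_lge0 ?invr_gt0// subr_ge0.
Qed.

Section moment_asymptotics.
Context {R : realType}.
Implicit Types (n l : nat).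

Let E0 : R := energy_lim 0.

Lemma energy_lim_ge0 d : 0 <= energy_lim d :> R.
Proof. by have [E E0' h] := @energy_cvg R d; rewrite (energy_lim_unique _ _ h). Qed.

(** The factor by which the limit energy grows from dimension 0 to 2n. *)
Definition sqr_dfact n : R := \prod_(j < n) (j.+1.*2%:R) ^+ 2.

Lemma sqr_dfactS n : sqr_dfact n.+1 = sqr_dfact n * (n.+1.*2%:R) ^+ 2.
Proof. by rewrite /sqr_dfact big_ord_recr. Qed.

Lemma sqr_dfact_gt0 n : 0 < sqr_dfact n.
Proof. by apply: prodr_gt0 => j _; rewrite exprn_gt0// ltr0n double_gt0. Qed.

Lemma energy_lim_even n : energy_lim n.*2 = sqr_dfact n * E0.
Proof.
elim: n => [|n IH]; first by rewrite /sqr_dfact big_ord0 mul1r.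
by rewrite doubleS -addn2 energy_lim_add2 IH addn2 sqr_dfactS -doubleS; ring.
Qed.

(** The moment of order d - l of phi_d along d = 2n, normalised by
    [sqr_dfact] and by d^l, tends to b as n goes to infinity. *)
Definition lim_moment l (b : R) := exists B : nat -> R,
  (\forall n \near \oo, has_moment n.*2 (n.*2 - l) (B n)) /\
  (n.*2%:R ^+ l * B n / sqr_dfact n @[n --> \oo] --> b).

Lemma cvg_inv_double : (n.*2%:R : R)^-1 @[n --> \oo] --> (0 : R).
Proof.
have h : 2^-1 * (n%:R : R)^-1 @[n --> \oo] --> 2^-1 * (0 : R).
  apply: cvgMr; apply/(@gtr0_cvgV0 _ _ _ _ (fun n : nat => n%:R : R)).
    by near=> n; rewrite ltr0n; near: n; exact: nbhs_infty_gt.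
  exact: cvgr_idn.
move: h; rewrite mulr0; apply: cvg_trans; apply: near_eq_cvg; near=> n.
by rewrite -muln2 natrM invfM mulrC.
Unshelve. all: by end_near. Qed.

Lemma has_moment_one n :
  has_moment n.+1.*2 n.*2.+1 (sqr_dfact n.+1 / n.+1.*2%:R).
Proof.
elim: n => [|n IH].
  rewrite sqr_dfactS /sqr_dfact big_ord0 (_ : _ / _ = 2); last by rewrite -[1.*2]/2%N; field.
  exact: has_moment_one_base.
have := @has_moment_one_step R _ _ IH.
rewrite -!doubleS; congr has_moment.
rewrite (sqr_dfactS n.+1).
have : n.+1.*2%:R != 0 :> R by rewrite pnatr_eq0 double_eq0.
have : n.+2.*2%:R != 0 :> R by rewrite pnatr_eq0 double_eq0.
set u := _%:R; set w := _%:R => u0 w0; clearbody u w.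
by field; rewrite u0 w0.
Qed.

Lemma lim_moment1 : lim_moment 1 1.
Proof.
exists (fun n => sqr_dfact n / n.*2%:R); split.
  near=> n; have n0 : (0 < n)%N by near: n; exact: nbhs_infty_gt.
  by rewrite -(prednK n0) subn1; exact: has_moment_one.
apply: cvg_near_cst; near=> n; have n0 : (0 < n)%N by near: n; exact: nbhs_infty_gt.
have : n.*2%:R != 0 :> R by rewrite pnatr_eq0 double_eq0 -lt0n.
have : sqr_dfact n != 0 by rewrite gt_eqF// sqr_dfact_gt0.
by move=> h1 h2; field; rewrite h1 h2.
Unshelve. all: by end_near. Qed.

Lemma cvg_ratio (a : R) :
  ((1 + a * (n.*2%:R)^-1) * (1 - a * (n.*2%:R)^-1))^-1 @[n --> \oo] --> (1 : R).
Proof.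
have ha : a * (n.*2%:R : R)^-1 @[n --> \oo] --> a * 0.
  by apply: cvgMr; exact: cvg_inv_double.
rewrite mulr0 in ha.
have h : (1 + a * (n.*2%:R)^-1) * (1 - a * (n.*2%:R)^-1) @[n --> \oo] -->
    ((1 + 0) * (1 - 0) : R).
  by apply: cvgM; [apply: cvgD|apply: cvgB] => //; exact: cvg_cst.
rewrite addr0 subr0 mulr1 in h.
by rewrite -[X in _ --> X]invr1; apply: cvgV => //; rewrite oner_eq0.
Qed.

Lemma lim_moment2 : lim_moment 2 (2 * E0).
Proof.
exists (fun n => 2 * energy_lim n.*2 / (n.*2.+1 * n.*2.-1)%:R); split.
  near=> n; have n0 : (0 < n)%N by near: n; exact: nbhs_infty_gt.
  have := @has_moment_two R n.-1.*2.
  have e : n.*2 = n.-1.*2.+2 by rewrite -doubleS prednK.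
  by rewrite e subn2 addn2.
have h : 2 * E0 * ((1 + 1 * (n.*2%:R)^-1) * (1 - 1 * (n.*2%:R)^-1))^-1
    @[n --> \oo] --> 2 * E0 * 1 by apply: cvgMr; exact: cvg_ratio.
rewrite mulr1 in h; apply: cvg_trans h; apply: near_eq_cvg; near=> n.
have n0 : (0 < n)%N by near: n; exact: nbhs_infty_gt.
rewrite energy_lim_even.
have : sqr_dfact n != 0 by rewrite gt_eqF// sqr_dfact_gt0.
have n2 : (1 < n.*2)%N by case: (n) n0 => // k _; rewrite doubleS.
have : n.*2%:R != 0 :> R by rewrite pnatr_eq0 double_eq0 -lt0n.
have : n.*2.+1%:R != 0 :> R by rewrite pnatr_eq0.
have : n.*2.-1%:R != 0 :> R by rewrite pnatr_eq0 -lt0n -ltnS prednK// ltnW.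
have -> : n.*2.-1%:R = n.*2%:R - 1 :> R.
  by rewrite -subn1 natrB// ltnW.
rewrite natrM -nat1r.
have -> : n.*2.-1%:R = n.*2%:R - 1 :> R.
  by rewrite -subn1 natrB// ltnW.
set u := n.*2%:R; clearbody u; move: E0 (sqr_dfact n) => e c u1 u1' u0 c0.
by field; rewrite u0 c0 u1 u1'.
Unshelve. all: by end_near. Qed.

(** The moment of order d - l - 2 is an explicit multiple of that of order d - l,
    and the factor tends to 4 l / (l+1) after normalisation. *)
Lemma lim_moment_step l b : (0 < l)%N -> lim_moment l b ->
  lim_moment l.+2 (4 * (l%:R / l.+1%:R * b)).
Proof.
move=> l0 [B [hB Bb]].
exists (fun n => 4 * l%:R * B n / ((n.*2.+1 + l) * l.+1 * (n.*2 - l.+1))%:R); split.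
  near=> n; have hn : has_moment n.*2 (n.*2 - l) (B n) by near: n.
  have nl : (l.+1 < n)%N by near: n; exact: nbhs_infty_gt.
  have nl2 : (l.+2 <= n.*2)%N by rewrite (leq_trans nl)// -addnn leq_addr.
  have e2 : (n.*2 - l = (n.*2 - l.+2).+2)%N.
    by rewrite -[in RHS]addn2 -addn2 subnDA subnK// leq_subRL ?addn2// ltnW// ltnW.
  have e1 : (n.*2 - l.+1 = (n.*2 - l.+2).+1)%N.
    by rewrite -[in RHS]addn1 -[l.+2]addn1 subnDA subnK// leq_subRL ?addn1// ltnW.
  rewrite e1; apply: has_moment_step => //; last by rewrite -e2.
  by rewrite -addnA [(2 + l)%N]addnC addn2 subnK.
have h : 4 * (l%:R / l.+1%:R * (n.*2%:R ^+ l * B n / sqr_dfact n)) *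
   ((1 + l.+1%:R * (n.*2%:R)^-1) * (1 - l.+1%:R * (n.*2%:R)^-1))^-1
    @[n --> \oo] --> 4 * (l%:R / l.+1%:R * b) * 1.
  by apply: cvgM; [do 2 apply: cvgMr; exact: Bb|exact: cvg_ratio].
rewrite mulr1 in h; apply: cvg_trans h; apply: near_eq_cvg; near=> n.
have nl : (l.+1 < n)%N by near: n; exact: nbhs_infty_gt.
have nl2 : (l.+2 <= n.*2)%N by rewrite (leq_trans nl)// -addnn leq_addr.
have c0 : sqr_dfact n != 0 by rewrite gt_eqF// sqr_dfact_gt0.
have u0 : n.*2%:R != 0 :> R by rewrite pnatr_eq0 -lt0n (leq_trans _ nl2).
have u1 : (n.*2.+1 + l)%:R != 0 :> R by rewrite pnatr_eq0.
have u2 : (n.*2 - l.+1)%:R != 0 :> R by rewrite pnatr_eq0 -lt0n subn_gt0.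
have l1 : l.+1%:R != 0 :> R by rewrite pnatr_eq0.
rewrite !natrM.
have e1 : (n.*2.+1 + l)%:R = n.*2%:R + l.+1%:R :> R.
  by rewrite -natrD addSnnS.
have e2 : (n.*2 - l.+1)%:R = n.*2%:R - l.+1%:R :> R by rewrite natrB// ltnW.
move: u1 u2; rewrite e1 e2 2!exprS; move: u0 c0 l1.
set u := n.*2%:R; set w := l.+1%:R; set c := sqr_dfact n.
clearbody u w c => u0 c0 l1 u1 u2.
by field; rewrite ?u0 ?c0 ?l1 ?u1 ?u2.
Unshelve. all: by end_near. Qed.

Lemma lim_moment_Cauchy_Schwarz l b0 b1 b2 : 0 <= b0 ->
  lim_moment l b0 -> lim_moment l.+1 b1 -> lim_moment l.+2 b2 ->
  b1 ^+ 2 <= b0 * b2.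
Proof.
move=> b0_ge0 [B0 [h0 c0]] [B1 [h1 c1]] [B2 [h2 c2]].
apply: discriminant_le0 => // x.
have h : x ^+ 2 * (n.*2%:R ^+ l * B0 n / sqr_dfact n) -
  2 * x * (n.*2%:R ^+ l.+1 * B1 n / sqr_dfact n) +
  n.*2%:R ^+ l.+2 * B2 n / sqr_dfact n @[n --> \oo] -->
  x ^+ 2 * b0 - 2 * x * b1 + b2.
  by apply: cvgD => //; apply: cvgB; apply: cvgMr.
apply: (@cvgr_to_ge _ _ _ _ _ _ _ h); near=> n.
have nl : (l.+1 < n)%N by near: n; exact: nbhs_infty_gt.
have nl2 : (l.+2 <= n.*2)%N by rewrite (leq_trans nl)// -addnn leq_addr.
have m0 : has_moment n.*2 (n.*2 - l) (B0 n) by near: n.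
have m1 : has_moment n.*2 (n.*2 - l.+1) (B1 n) by near: n.
have m2 : has_moment n.*2 (n.*2 - l.+2) (B2 n) by near: n.
have e2 : (n.*2 - l = (n.*2 - l.+2).+2)%N.
  by rewrite -[in RHS]addn2 -addn2 subnDA subnK// leq_subRL ?addn2// ltnW// ltnW.
have e1 : (n.*2 - l.+1 = (n.*2 - l.+2).+1)%N.
  by rewrite -[in RHS]addn1 -[l.+2]addn1 subnDA subnK// leq_subRL ?addn1// ltnW.
rewrite e2 in m0; rewrite e1 in m1.
have u0 : n.*2%:R != 0 :> R by rewrite pnatr_eq0 -lt0n (leq_trans _ nl2).
(* The variable is rescaled by d = 2n, as the moments are. *)
have := has_moment_quad_ge0 _ _ _ _ _ (x / n.*2%:R) m0 m1 m2.
have c_gt0 := sqr_dfact_gt0 n.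
rewrite -(pmulr_rge0 _ (_ : 0 < n.*2%:R ^+ l.+2 / sqr_dfact n)); last first.
  by rewrite divr_gt0// exprn_gt0// lt0r u0/=.
congr (_ <= _); rewrite !exprS; move: u0 c_gt0 => /=.
set u := n.*2%:R; set c := sqr_dfact n; clearbody u c => u0 /lt0r_neq0 cN0.
by field; rewrite u0 cN0.
Unshelve. all: by end_near. Qed.

(** The normalised moments are Wallis integrals up to a constant that depends on
    the parity: 1/pi where the recursion starts from the exact moment of order
    d - 1, half of the limit energy where it starts from the moment of order
    d - 2.  The aim is to prove that the two are equal. *)
Definition wallis_cst l : R := if odd l then E0 / 2 else pi^-1.

Lemma wallis_cst_ge0 l : 0 <= wallis_cst l.
Proof.
rewrite /wallis_cst; case: ifP => _; last by rewrite invr_ge0 pi_ge0.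
by rewrite divr_ge0// energy_lim_ge0.
Qed.

Lemma lim_moment_wallis l : lim_moment l.+1 (2 ^+ l.+1 * (wallis_cst l * wallis l)).
Proof.
suff : lim_moment l.+1 (2 ^+ l.+1 * (wallis_cst l * wallis l)) /\
  lim_moment l.+2 (2 ^+ l.+2 * (wallis_cst l.+1 * wallis l.+1)) by case.
elim: l => [|l [h1 h2]].
  split.
    rewrite (_ : _ * _ = 1); first exact: lim_moment1.
    have p0 : pi != 0 :> R by rewrite gt_eqF// pi_gt0.
    by rewrite /wallis_cst/=; move: p0; generalize (@pi R) => p p0; field.
  rewrite (_ : _ * _ = 2 * E0); first exact: lim_moment2.
  by rewrite /wallis_cst/=; field.
split=> //; have := lim_moment_step l.+1 _ isT h1.
congr lim_moment; rewrite /wallis_cst/= negbK !exprS.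
by case: ifP => _; ring.
Qed.

(** The Cauchy-Schwarz inequality for three consecutive moments.  The outer two
    have the same constant, and the Wallis integrals decrease by a factor of at
    least (l+1)/(l+2) from one to the next. *)
Lemma wallis_cst_le l : wallis_cst l.+1 * (l.+1%:R / l.+2%:R) <= wallis_cst l.
Proof.
have w0 := wallis_gt0 (R := R) l.
have h := lim_moment_Cauchy_Schwarz l.+1 _ _ _ _ (lim_moment_wallis l)
  (lim_moment_wallis l.+1) (lim_moment_wallis l.+2).
have {h} : (wallis_cst l.+1 * wallis l.+1) ^+ 2 <= (wallis_cst l * wallis l) ^+ 2.
  have : 0 <= 2 ^+ l.+1 * (wallis_cst l * wallis l).
    by rewrite !mulr_ge0 ?exprn_ge0 ?wallis_cst_ge0// ltW.
  move=> /h; have -> : wallis_cst l.+2 = wallis_cst l by rewrite /wallis_cst/= negbK.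
  have -> : 2 ^+ l.+1 * (wallis_cst l * wallis l) * (2 ^+ l.+3 * (wallis_cst l * wallis l.+2)) =
    (2 ^+ l.+2) ^+ 2 * (wallis_cst l * wallis l * (wallis_cst l * wallis l.+2)).
    by rewrite !exprS; ring.
  rewrite exprMn ler_pM2l ?exprn_gt0// => /le_trans; apply.
  rewrite expr2 ler_wpM2l ?mulr_ge0 ?wallis_cst_ge0// ?(ltW w0)//.
  rewrite ler_wpM2l ?wallis_cst_ge0//.
  exact: le_trans (wallis_le _) (wallis_le _).
rewrite ler_sqr ?nnegrE ?mulr_ge0 ?wallis_cst_ge0 ?(ltW (wallis_gt0 _))// => h.
rewrite -(ler_pM2r w0); apply: le_trans h.
rewrite -mulrA ler_wpM2l ?wallis_cst_ge0//.
exact: (wallis_le l.+1).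
Qed.

(** (l+1)/(l+2) tends to 1 along each parity class. *)
Lemma le_of_ratio (a b : R) (p : bool) : 0 <= a ->
  (forall l, odd l = p -> a * (l.+1%:R / l.+2%:R) <= b) -> a <= b.
Proof.
move=> a0 h; rewrite leNgt; apply/negP => ba.
have ab0 : 0 < a - b by rewrite subr_gt0.
(* If b < a, then a (l+1)/(l+2) exceeds b once l + 2 > a / (a - b). *)
pose N := (Num.truncn (a / (a - b))).+1.
pose l := (N.*2 + p)%N.
have ol : odd l = p by rewrite /l oddD odd_double/=; case: (p).
have := h l ol.
have lN : a / (a - b) < l.+2%:R.
  apply: (lt_le_trans (truncnS_gt _)); rewrite ler_nat.
  rewrite -/N; apply: (@leq_trans N.*2); first by rewrite -addnn leq_addr.
  exact: leqW (leqW (leq_addr _ _)).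
rewrite ltr_pdivrMr// in lN.
have : l.+1%:R = l.+2%:R - 1 :> R by rewrite -[l.+2%:R]natr1 addrK.
move=> ->; rewrite mulrA ler_pdivrMr//.
rewrite mulrBr mulr1; nra.
Qed.

(** The inequality between the two constants holds in both directions, as l runs
    through even or odd numbers. *)
Lemma energy_lim0 : energy_lim 0 = 2 / pi :> R.
Proof.
have e1 : E0 / 2 <= pi^-1.
  apply: (le_of_ratio _ _ false); first by rewrite divr_ge0// energy_lim_ge0.
  by move=> l ol; have := wallis_cst_le l; rewrite /wallis_cst/= ol.
have e2 : pi^-1 <= E0 / 2.
  apply: (le_of_ratio _ _ true); first by rewrite invr_ge0 pi_ge0.
  by move=> l ol; have := wallis_cst_le l; rewrite /wallis_cst/= ol.
have : E0 / 2 = pi^-1 by apply/eqP; rewrite eq_le e1 e2.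
by rewrite -/E0 => h; rewrite -h; field.
Qed.

End moment_asymptotics.

(** * Gamma at half-integers and the Bessel kernel *)

Section gamma_half.
Context {R : realType}.
Implicit Types (n d : nat) (t g : R).
Local Notation mu := (@lebesgue_measure R).

(** The Gamma integrand t^(n/2) exp(-t).  The square root keeps it continuous on
    the whole line, also for odd n, where the fundamental theorem of calculus is
    applied. *)
Definition gamma_fun n t : R := Num.sqrt t ^+ n * expR (- t).

Lemma gamma_fun_ge0 n t : 0 <= gamma_fun n t.
Proof. by rewrite mulr_ge0 ?expR_ge0// exprn_ge0// sqrtr_ge0. Qed.

Lemma continuous_gamma_fun n : continuous (gamma_fun n).
Proof.
move=> t; apply: cvgM.
  apply: (@continuous_cvg _ _ _ _ _ (@Num.sqrt R) (fun x => x ^+ n)).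
    exact: exprn_continuous.
  exact: sqrt_continuous.
apply: (@continuous_cvg _ _ _ _ _ (fun x : R => - x) (@expR R)).
  exact: continuous_expR.
by apply: cvgN; exact: cvg_id.
Qed.

Lemma cvg_gamma_fun n : gamma_fun n t @[t --> +oo] --> (0 : R).
Proof.
apply: (@cvg0_le_div _ _ (n.+1)`!%:R) => t t1.
have t0 : 0 < t by apply: lt_le_trans t1.
rewrite ger0_norm ?gamma_fun_ge0// /gamma_fun.
have st : Num.sqrt t <= t.
  rewrite -{2}(ger0_norm (ltW t0)) -sqrtr_sqr ler_sqrt ?sqr_ge0//.
  by rewrite expr2 ler_peMr// ltW.
apply: (@le_trans _ _ (t ^+ n * expR (- t))).
  by rewrite ler_wpM2r ?expR_ge0// lerXn2r ?nnegrE ?sqrtr_ge0// ltW.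
rewrite ler_pdivlMr// mulrAC -exprSr expRN ler_pdivrMr ?expR_gt0//.
have h := @expR_ge1Dxn R t n (ltW t0).
rewrite mulrC -ler_pdivrMr ?ltr0n ?fact_gt0//.
by apply: le_trans h; rewrite lerDr.
Qed.

Lemma is_derive_expRN t : is_derive t (1 : R) (fun y => expR (- y)) (- expR (- t)).
Proof.
have := @is_derive_chain R expR (fun y => - y) t _ _ (is_derive_expR _)
  (is_derive_opp _ _ _ (is_derive_ident t)).
by rewrite mulrN1.
Qed.

(** Gamma(n/2+1) = g, stated with an antiderivative so that the functional
    equation is an instance of the product rule. *)
Definition has_gamma n g := exists T : R -> R,
  [/\ forall t, 0 < t -> is_derive t (1 : R) T (gamma_fun n t),
      T t @[t --> 0^'+] --> T 0, T 0 = 0 & T t @[t --> +oo] --> g].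

Lemma Gamma_of_has_gamma n g : has_gamma n g -> Gamma (n%:R / 2 + 1) = g.
Proof.
move=> [T [dT cT T0 Tg]].
have sE (t : R) : 0 <= t -> t `^ (n%:R / 2 + 1 - 1) * expR (- t) = gamma_fun n t.
  by move=> t0; rewrite addrK [n%:R / 2]mulrC powRrM powR12_sqrt// powR_mulrn ?sqrtr_ge0.
have := @ge0_continuous_FTC2y R (gamma_fun n) T 0 g.
rewrite T0 sube0 => h.
rewrite /Gamma /Rintegral.
have -> : (\int[mu]_(t in `]0%R, +oo[) (t `^ (n%:R / 2 + 1 - 1) * expR (- t))%:E =
  \int[mu]_(t in `[0%R, +oo[) (gamma_fun n t)%:E)%E.
  rewrite -integral_itv_obnd_cbnd; last first.
    apply/measurable_EFinP; apply: measurable_funTS.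
    by apply: continuous_measurable_fun; exact: continuous_gamma_fun.
  apply: eq_integral => t; rewrite inE/= in_itv/= andbT => t0.
  by rewrite sE// ltW.
rewrite h//.
- by move=> t _; exact: gamma_fun_ge0.
- by apply: continuous_subspaceT; exact: continuous_gamma_fun.
- by move=> t t0; have [] := dT _ t0.
- by rewrite T0 in cT.
- move=> t; rewrite in_itv/= andbT => t0; have ht := dT _ t0.
  by rewrite derive1E derive_val.
Qed.

Lemma has_gamma_step n g : has_gamma n g -> has_gamma n.+2 ((n%:R / 2 + 1) * g).
Proof.
move=> [T [dT cT T0 Tg]].
have c0 : gamma_fun n.+2 0 = 0 by rewrite /gamma_fun sqrtr0 expr0n/= mul0r.
exists (fun t => (n%:R / 2 + 1) * T t - gamma_fun n.+2 t); split.
- move=> t t0; have h := dT _ t0; have hs := is_derive1_sqrt t0.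
  have he := is_derive_expRN t.
  have s0 : Num.sqrt t != 0 by rewrite gt_eqF// sqrtr_gt0.
  rewrite /gamma_fun; derive_all => /=.
  rewrite /gamma_fun -[n.+2%:R]natr1 -[n.+1%:R]natr1 !exprS.
  by field.
- rewrite c0 T0; have -> : (n%:R / 2 + 1) * 0 - 0 = (n%:R / 2 + 1) * T 0 - gamma_fun n.+2 0.
    by rewrite c0 T0.
  apply: cvgB; first exact: cvgMr.
  apply: cvg_at_right_filter; exact: continuous_gamma_fun.
- by rewrite T0 c0 mulr0 subr0.
- rewrite -[X in _ --> X]subr0; apply: cvgB; first exact: cvgMr.
  exact: cvg_gamma_fun.
Qed.

Lemma has_gamma0 : has_gamma 0 1.
Proof.
have c (t : R) : {for t, continuous (fun t : R => 1 - gamma_fun 0 t)}.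
  by apply: cvgB; [exact: cvg_cst|exact: continuous_gamma_fun].
exists (fun t => 1 - gamma_fun 0 t); split.
- move=> t t0.
  have he := is_derive_expRN t.
  have -> : (fun t => 1 - gamma_fun 0 t) = (fun t => 1 - expR (- t)).
    by apply/funext => x; rewrite /gamma_fun expr0 mul1r.
  by derive_all; rewrite /gamma_fun expr0; ring.
- by apply: cvg_at_right_filter; exact: c.
- by rewrite /gamma_fun expr0 oppr0 expR0 mul1r subrr.
- rewrite -[X in _ --> X]subr0; apply: cvgB; first exact: cvg_cst.
  exact: cvg_gamma_fun.
Qed.

(** Substituting t = u^2 in Gamma(3/2), by parts, gives the Gauss integral. *)
Lemma has_gamma1 : has_gamma 1 (Num.sqrt pi / 2).
Proof.
pose I : R -> R := gauss_integral_proof.integral0_gauss.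
have ig (u : R) : mu.-integrable `[0, u] (EFin \o gauss_fun).
  apply: continuous_compact_integrable; first exact: segment_compact.
  by apply: continuous_subspaceT; exact: continuous_gauss_fun.
have dI (x : R) : 0 < x -> is_derive x (1 : R) I (gauss_fun x).
  move=> x0; have [||||h1 h2] := @continuous_FTC1 R gauss_fun (BLeft 0) x (x + 1).
  - by rewrite ltrDl.
  - exact: ig.
  - by rewrite /= lte_fin.
  - exact: continuous_gauss_fun.
  apply: DeriveDef; first exact: h1.
  by rewrite -derive1E; exact: h2.
have I0 : I 0 = 0.
  by rewrite /I /gauss_integral_proof.integral0_gauss set_itv1 Rintegral_set1.
have cI0 : I x @[x --> (0 : R)] --> (0 : R).
  exact: (@parameterized_integral_cvg_left R 0 1 gauss_fun ltr01 (ig 1)).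
have Ig : I x @[x --> +oo] --> Num.sqrt pi / 2.
  have : Num.sqrt (I x ^+ 2) @[x --> +oo] --> Num.sqrt (pi / 4).
    apply: continuous_cvg => //; first exact: sqrt_continuous.
    exact: gauss_integral_proof.cvg_integral0_gauss_sqr.
  rewrite sqrtrM ?pi_ge0// sqrtrV// (_ : 4 = 2 ^+ 2); last by rewrite expr2 -natrM.
  rewrite sqrtr_sqr ger0_norm//.
  rewrite (_ : (fun _ => Num.sqrt _) = I)//; apply/funext => r.
  by rewrite sqrtr_sqr ger0_norm// gauss_integral_proof.integral0_gauss_ge0.
have cI : I (Num.sqrt t) @[t --> 0^'+] --> (0 : R).
  apply: cvg_at_right_filter.
  have s0 : Num.sqrt t @[t --> (0 : R)] --> (0 : R).
    by have := @sqrt_continuous R 0; rewrite /continuous_at sqrtr0.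
  exact: (cvg_comp _ _ s0 cI0).
have ysqrt : Num.sqrt t @[t --> +oo] --> (+oo : set_system R).
  apply/cvgryPge => A; near=> t.
  have At : A ^+ 2 <= t by near: t; apply: nbhs_pinfty_ge; rewrite num_real.
  by rewrite (le_trans (ler_norm A))// -sqrtr_sqr ler_wsqrtr.
exists (fun t => I (Num.sqrt t) - gamma_fun 1 t); split.
- move=> t t0; have hs := is_derive1_sqrt t0.
  have s0 : 0 < Num.sqrt t by rewrite sqrtr_gt0.
  have he := is_derive_expRN t.
  have hI := is_derive_chain _ _ _ _ _ (dI _ s0) hs.
  rewrite /gamma_fun; derive_all => /=.
  rewrite /gamma_fun /gauss_fun sqr_sqrtr ?(ltW t0)//.
  by field; rewrite gt_eqF.
- rewrite sqrtr0 I0; apply: cvgB.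
    exact: cI.
  by apply: cvg_at_right_filter; exact: continuous_gamma_fun.
- by rewrite sqrtr0 I0 /gamma_fun sqrtr0 expr1 mul0r subrr.
- rewrite -[X in _ --> X]subr0; apply: cvgB; first exact: (cvg_comp _ _ ysqrt Ig).
  exact: cvg_gamma_fun.
Unshelve. all: by end_near. Qed.

Lemma has_gamma_Gamma n : has_gamma n (Gamma (n%:R / 2 + 1)).
Proof.
have h k g : has_gamma k g -> has_gamma k (Gamma (k%:R / 2 + 1)).
  by move=> hg; rewrite (Gamma_of_has_gamma _ _ hg).
suff [] : has_gamma n (Gamma (n%:R / 2 + 1)) /\
  has_gamma n.+1 (Gamma (n.+1%:R / 2 + 1)) by [].
elim: n => [|n [h1 h2]]; first by split; [exact: h has_gamma0|exact: h has_gamma1].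
split; first exact: h2.
exact: h (has_gamma_step _ _ h1).
Qed.

Lemma Gamma_half_rec n :
  Gamma (n.+2%:R / 2 + 1) = (n%:R / 2 + 1) * Gamma (n%:R / 2 + 1) :> R.
Proof. exact: Gamma_of_has_gamma (has_gamma_step _ _ (has_gamma_Gamma n)). Qed.

Lemma Gamma_half_gt0 n : 0 < Gamma (n%:R / 2 + 1) :> R.
Proof.
suff [] : 0 < Gamma (n%:R / 2 + 1) :> R /\ 0 < Gamma (n.+1%:R / 2 + 1) :> R by [].
elim: n => [|n [h1 h2]].
  rewrite (Gamma_of_has_gamma _ _ has_gamma0) (Gamma_of_has_gamma _ _ has_gamma1).
  by rewrite divr_gt0// sqrtr_gt0 pi_gt0.
split; first exact: h2.
rewrite Gamma_half_rec; apply: mulr_gt0; last exact: h1.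
by rewrite ltr_wpDl// divr_ge0.
Qed.

(** Both sides have the same recursion d -> d + 2 and agree for d = 0, 1. *)
Lemma energy_lim_Gamma d :
  energy_lim d = 2 ^+ d.+1 * Gamma (d%:R / 2 + 1) ^+ 2 / pi :> R.
Proof.
have p0 : pi != 0 :> R by rewrite gt_eqF// pi_gt0.
suff [] : energy_lim d = 2 ^+ d.+1 * Gamma (d%:R / 2 + 1) ^+ 2 / pi :> R /\
  energy_lim d.+1 = 2 ^+ d.+2 * Gamma (d.+1%:R / 2 + 1) ^+ 2 / pi :> R by [].
elim: d => [|d [h1 h2]].
  rewrite (Gamma_of_has_gamma _ _ has_gamma0) (Gamma_of_has_gamma _ _ has_gamma1).
  rewrite energy_lim0 energy_lim1 exprMn sqr_sqrtr ?pi_ge0//.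
  by split; move: p0; generalize (@pi R) => p p0; field.
split; first exact: h2.
rewrite -addn2 energy_lim_add2 h1 addn2 Gamma_half_rec.
rewrite -[d.+2%:R]natr1 -[d.+1%:R]natr1.
move: p0; generalize (@pi R) => p p0; rewrite !exprS.
by generalize (Gamma (d%:R / 2 + 1) : R) => G; field.
Qed.

(** Identifies [phi_den] with the Gamma factors of the Bessel series. *)
Lemma phi_den_Gamma d m :
  Gamma ((d + m.*2)%:R / 2 + 1) * (m`!)%:R * 4 ^+ m =
  Gamma (d%:R / 2 + 1) * (phi_den d m)%:R :> R.
Proof.
elim: m => [|m IH].
  by rewrite addn0 /phi_den big_ord0 !mulr1.
rewrite doubleS !addnS Gamma_half_rec phi_denS factS exprS !natrM.
rewrite [RHS]mulrA -IH -[m.+1.*2]mul2n natrD natrM natrD -[m.*2]mul2n natrM.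
by rewrite -natr1; field.
Qed.

Lemma besselJ_phi d (s : R) : 0 < s ->
  besselJ (d%:R / 2) s = (s / 2) `^ (d%:R / 2) / Gamma (d%:R / 2 + 1) * phi d s.
Proof.
move=> s0; apply/cvg_lim => //.
set c := (s / 2) `^ (d%:R / 2) / Gamma (d%:R / 2 + 1).
have h : c * pseries (phi_coef d) (s ^+ 2) n @[n --> \oo] --> c * phi d s.
  by apply: cvgMr; exact: is_cvg_pseries_phi.
apply: cvg_trans h; apply: near_eq_cvg; near=> n.
rewrite /pseries/series/= mulr_sumr; apply: eq_bigr => i _.
rewrite /c /phi_coef.
have -> : i%:R + d%:R / 2 + 1 = (d + i.*2)%:R / 2 + 1 :> R.
  by rewrite natrD -mul2n natrM; field.
have s2 : 0 < s / 2 by rewrite divr_gt0.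
rewrite powRD; last by rewrite (gt_eqF s2) implybT.
rewrite powR_mulrn ?(ltW s2)//.
have -> : (s / 2) ^+ i.*2 = (s ^+ 2) ^+ i / 4 ^+ i.
  rewrite -mul2n exprM (_ : (s / 2) ^+ 2 = s ^+ 2 / 4); last by field.
  by rewrite exprMn exprVn.
have g0 := Gamma_half_gt0 d; have g1 := Gamma_half_gt0 (d + i.*2).
have f0 : (i`!)%:R != 0 :> R by rewrite pnatr_eq0 -lt0n fact_gt0.
have h4 : 4 ^+ i != 0 :> R by rewrite expf_neq0.
have hd := phi_den_neq0 (R := R) d i.
have e : (phi_den d i)%:R =
   Gamma ((d + i.*2)%:R / 2 + 1) * (i`!)%:R * 4 ^+ i / Gamma (d%:R / 2 + 1) :> R.
  by rewrite phi_den_Gamma mulrC mulKf// gt_eqF.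
rewrite e; move: g0 g1 f0 h4 => /lt0r_neq0 + /lt0r_neq0.
generalize (Gamma ((d + i.*2)%:R / 2 + 1) : R) (Gamma (d%:R / 2 + 1) : R).
generalize (i`!%:R : R) ((s / 2) `^ (d%:R / 2)) => b w G G' h1 h2 h3 h5.
by field; rewrite ?h1 ?h2 ?h3 ?h5.
Unshelve. all: by end_near. Qed.

End gamma_half.

Section kernel.
Context {R : realType} (d : nat).
Implicit Types x y : euclidean R d.

Lemma euclidean_dist_ge0 x y : 0 <= Defs.edist x y.
Proof. exact: sqrtr_ge0. Qed.

Lemma euclidean_dist_gt0 x y : x != y -> 0 < Defs.edist x y.
Proof.
move=> xy; rewrite sqrtr_gt0 lt_neqAle sumr_ge0 ?andbT; last first.
  by move=> i _; rewrite sqr_ge0.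
apply: contra xy => /eqP/esym/psumr_eq0P h; apply/eqP/eq_from_tnth => i.
apply/eqP; rewrite -subr_eq0 -sqrf_eq0 h// => j _; exact: sqr_ge0.
Qed.

Lemma euclidean_distxx x : Defs.edist x x = 0.
Proof.
by rewrite /Defs.edist big1 ?sqrtr0// => i _; rewrite subrr expr0n.
Qed.

Lemma bessel_kernel_phi (L : R) x y : 0 < L ->
  bessel_kernel L x y = L ^+ d * phi d (L * pi * Defs.edist x y).
Proof.
move=> L0; rewrite /bessel_kernel; case: eqVneq => [->|xy].
  by rewrite euclidean_distxx mulr0 phi0 mulr1.
have r0 := euclidean_dist_gt0 _ _ xy; have p0 : 0 < pi :> R := pi_gt0 R.
have pr0 : 0 < pi * Defs.edist x y by rewrite mulr_gt0.
rewrite besselJ_phi; last by rewrite !mulr_gt0.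
have -> : (L * pi * Defs.edist x y / 2) `^ (d%:R / 2) =
    L `^ (d%:R / 2) * ((pi * Defs.edist x y) `^ (d%:R / 2) / 2 `^ (d%:R / 2)).
  have -> : L * pi * Defs.edist x y / 2 = L * ((pi * Defs.edist x y) * 2^-1).
    by ring.
  rewrite (powRM _ (ltW L0)); last by rewrite mulr_ge0 ?invr_ge0// ltW.
  rewrite (powRM _ (ltW pr0)) ?invr_ge0//; congr (_ * (_ * _)).
  by rewrite -powRN -[2^-1]powR_inv1// -powRrM mulN1r.
have -> : L ^+ d = L `^ (d%:R / 2) * L `^ (d%:R / 2).
  rewrite -powRD; last by rewrite (gt_eqF L0) implybT.
  by rewrite -mulrDl -mulr2n -[d%:R *+ 2]mulr_natr mulfK// powR_mulrn// ltW.
have := Gamma_half_gt0 (R := R) d; move=> /lt0r_neq0.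
have : (pi * Defs.edist x y) `^ (d%:R / 2) != 0 by rewrite gt_eqF// powR_gt0.
have : 2 `^ (d%:R / 2) != 0 :> R by rewrite gt_eqF// powR_gt0.
generalize (2 `^ (d%:R / 2) : R) ((pi * Defs.edist x y) `^ (d%:R / 2)).
generalize (L `^ (d%:R / 2)) (Gamma (d%:R / 2 + 1) : R).
generalize (phi d (L * pi * Defs.edist x y)).
move=> p a G b c h1 h2 h3; field.
by rewrite ?h1 ?h2 ?h3.
Qed.

End kernel.

(** * Oscillating kernels that average to zero *)

Section weak_null.
Context d (T : measurableType d) (R : realType).
Variables (m : {measure set T -> \bar R}) (D : set T) (mD : measurable D).
Variables (k : nat -> T -> R) (C : R).
Hypothesis mk : forall n, measurable_fun D (k n).
Hypothesis kC : forall n x, D x -> `|k n x| <= C.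
Implicit Types f g : T -> R.

(** The bounded kernels k n tend to zero weakly when tested against f; the aim is
    to have this for every integrable f, a Riemann-Lebesgue lemma. *)
Definition weak_null f := \int[m]_(x in D) (f x * k n x) @[n --> \oo] --> (0 : R).

Lemma integrable_mul f n : m.-integrable D (EFin \o f) ->
  m.-integrable D (EFin \o (fun x => f x * k n x)).
Proof.
move=> fi; have : m.-integrable D ((EFin \o k n) \* (EFin \o f))%E.
  apply: integrableMr => //; exists C; split; first exact: num_real.
  move=> M CM x Dx; apply: (le_trans (kC n x Dx)); exact: ltW.
by apply: eq_integrable => // x _; rewrite /= -EFinM mulrC.
Qed.

Lemma integrable_sub f g : m.-integrable D (EFin \o f) ->
  m.-integrable D (EFin \o g) -> m.-integrable D (EFin \o (fun x => f x - g x)).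
Proof.
move=> fi gi; have := integrableB mD fi gi.
by apply: eq_integrable => // x _; rewrite /= EFinB.
Qed.

Lemma integrable_normr f : m.-integrable D (EFin \o f) ->
  m.-integrable D (EFin \o (fun x => `|f x|)).
Proof. by move=> /integrable_norm. Qed.

Lemma weak_null_linear f g (a : R) :
  m.-integrable D (EFin \o f) -> m.-integrable D (EFin \o g) ->
  weak_null f -> weak_null g -> weak_null (fun x => a * f x + g x).
Proof.
move=> fi gi wf wg; rewrite /weak_null.
have -> : (fun n => \int[m]_(x in D) ((a * f x + g x) * k n x)) =
  (fun n => a * \int[m]_(x in D) (f x * k n x) + \int[m]_(x in D) (g x * k n x)).
  apply/funext => n; rewrite -RintegralZl//; last exact: integrable_mul.
  rewrite -RintegralD//; last 2 first.
  - have := integrableZl mD a (integrable_mul _ n fi).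
    by apply: eq_integrable => // x _; rewrite /= EFinM.
  - exact: integrable_mul.
  by apply: eq_Rintegral => x _; ring.
rewrite -[X in _ --> X](addr0) -[X in _ --> X + _](mulr0 a).
by apply: cvgD => //; apply: cvgMr.
Qed.

Lemma weak_null0 : weak_null (fun=> 0).
Proof.
rewrite /weak_null; under eq_fun do under eq_Rintegral do rewrite mul0r.
rewrite Rintegral_cst// mul0r; exact: cvg_cst.
Qed.

Lemma norm_int_mul_le f n : m.-integrable D (EFin \o f) ->
  `|\int[m]_(x in D) (f x * k n x)| <= C * \int[m]_(x in D) `|f x|.
Proof.
move=> fi; have fki := integrable_mul f n fi.
apply: (le_trans (le_normr_Rintegral mD fki)).
rewrite -RintegralZl//; last exact: integrable_normr.
apply: le_Rintegral => //.
- exact: integrable_normr.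
- have := integrableZl mD C (integrable_normr f fi).
  by apply: eq_integrable => // x _; rewrite /= EFinM.
by move=> x Dx; rewrite normrM mulrC ler_wpM2r ?kC.
Qed.

(** The set of admissible f is closed in the norm of L^1 because the kernels are
    uniformly bounded. *)
Lemma weak_null_closed f (g : nat -> T -> R) :
  m.-integrable D (EFin \o f) ->
  (forall j, m.-integrable D (EFin \o g j)) ->
  (forall j, weak_null (g j)) ->
  (\int[m]_(x in D) `|(f x)%:E - (g j x)%:E| @[j --> \oo] --> 0)%E ->
  weak_null f.
Proof.
move=> fi gi wg fg; apply/cvgr0Pnorm_lt => e e0.
have C0 : 0 <= `|C| by [].
have e2 : 0 < e / 2 / (`|C| + 1) by rewrite !divr_gt0// ltr_wpDl.
have fg' : \int[m]_(x in D) `|f x - g j x| @[j --> \oo] --> (0 : R).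
  by have /fine_cvgP[_] := fg.
have /cvgr0Pnorm_lt/(_ _ e2) fge := fg'.
near \oo => j.
have hj : `|\int[m]_(x in D) `|f x - g j x| | < e / 2 / (`|C| + 1) by near: j.
have /cvgr0Pnorm_lt/(_ (e / 2)) wgj := wg j.
have e20 : 0 < e / 2 by rewrite divr_gt0.
have := wgj e20; apply: filterS => n gn.
have fgi := integrable_sub _ _ fi (gi j).
have -> : \int[m]_(x in D) (f x * k n x) =
  \int[m]_(x in D) ((f x - g j x) * k n x) + \int[m]_(x in D) (g j x * k n x).
  rewrite -RintegralD//; [|exact: integrable_mul|exact: integrable_mul].
  by apply: eq_Rintegral => x _; ring.
rewrite (splitr e); apply: (le_lt_trans (ler_normD _ _)); apply: ltrD => //.
apply: (le_lt_trans (norm_int_mul_le _ n fgi)).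
move: hj; set I := Rintegral _ _ _; rewrite ltr_pdivlMr ?ltr_wpDl// => hj.
apply: le_lt_trans hj.
have I0 : 0 <= I by apply: Rintegral_ge0.
rewrite (ger0_norm I0) mulrC ler_wpM2l// (le_trans (ler_norm C))// lerDl//.
Unshelve. all: by end_near. Qed.

Hypothesis mDfin : (m D < +oo)%E.

Lemma integrable_le_cst (h : T -> R) (K : R) : measurable_fun D h ->
  (forall x, D x -> `|h x| <= K) -> m.-integrable D (EFin \o h).
Proof.
move=> mh hK; apply: measurable_bounded_integrable => //.
exists K; split; first exact: num_real.
by move=> M KM x Dx; apply: (le_trans (hK x Dx)); exact: ltW.
Qed.

Lemma integrable_indic_fin (A : set T) : measurable A ->
  m.-integrable D (EFin \o \1_A).
Proof.
move=> mA; apply: (@integrable_le_cst _ 1).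
  by apply: measurable_funTS; exact: measurable_indic.
by move=> x _; rewrite indicE; case: (x \in A); rewrite ?normr1 ?normr0.
Qed.

Import HBSimple.

Lemma weak_null_sfun (g : {sfun T >-> R}) :
  (forall A, measurable A -> weak_null \1_A) ->
  weak_null g.
Proof.
move=> wA.
have [r gE] : exists r : seq R, (g : T -> R) =
    fun x => \sum_(y <- r) (y * \1_(g @^-1` [set y]) x).
  exists (finmap.enum_fset (fset_set (range g))); apply/funext => x.
  by rewrite fimfunE fsbig_finite.
have mg y : measurable (g @^-1` [set y]) by [].
rewrite gE; move: r {gE} => r.
suff [] : weak_null (fun x => \sum_(y <- r) (y * \1_(g @^-1` [set y]) x)) /\
  m.-integrable D (EFin \o (fun x => \sum_(y <- r) (y * \1_(g @^-1` [set y]) x)))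
  by [].
elim: r => [|y r [w1 i1]].
  have -> : (fun x => \sum_(y <- [::]) (y * \1_(g @^-1` [set y]) x)) = (fun=> 0).
    by apply/funext => x; rewrite big_nil.
  by split; [exact: weak_null0|exact: integrable0].
have -> : (fun x => \sum_(z <- y :: r) (z * \1_(g @^-1` [set z]) x)) =
  (fun x => y * \1_(g @^-1` [set y]) x + \sum_(z <- r) (z * \1_(g @^-1` [set z]) x)).
  by apply/funext => x; rewrite big_cons.
have i2 := integrable_indic_fin _ (mg y).
split; first by apply: weak_null_linear => //; exact: wA.
have := integrableD mD (integrableZl mD y i2) i1.
by apply: eq_integrable => // x _; rewrite /= EFinD EFinM.
Qed.

(** The admissible sets form a Dynkin system: countable disjoint unions are limits
    in L^1 of finite ones on a space of finite measure. *)
Lemma weak_null_measurable (G : set (set T)) :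
  @measurable _ T = <<s G >> -> setI_closed G ->
  weak_null (fun=> 1) -> (forall A, G A -> weak_null \1_A) ->
  forall A, measurable A -> weak_null \1_A.
Proof.
move=> GE GI w1 wG.
suff h A : <<s G >> A -> weak_null \1_A by move=> A; rewrite GE; exact: h.
have i1 : m.-integrable D (EFin \o (fun=> 1)).
  by apply: (@integrable_le_cst _ 1) => // x _; rewrite normr1.
apply: (@dynkin_induction _ T G (fun A => weak_null \1_A)) => //.
- by rewrite indicT.
- move=> S mS wS.
  have -> : \1_(~` S) = (fun x => -1 * \1_S x + 1) :> (T -> R).
    apply/funext => x; rewrite !indicE in_setC.
    by case: (x \in S) => /=; ring.
  by apply: (weak_null_linear _ (fun=> 1)) => //; exact: integrable_indic_fin.
- move=> F mF tF wF.
  have mU : measurable (\bigcup_k0 F k0) by exact: bigcup_measurable.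
  pose U j := \bigcup_(i in `I_j) F i.
  have mU' j : measurable (U j) by exact: bigcup_measurable.
  apply: (weak_null_closed _ (fun j => \1_(U j))).
  + exact: integrable_indic_fin.
  + by move=> j; exact: integrable_indic_fin.
  + elim=> [|j IH].
      by rewrite /U II0 bigcup_set0 indic0; exact: weak_null0.
    have -> : \1_(U j.+1) = (fun x => 1 * \1_(F j) x + \1_(U j) x) :> (T -> R).
      apply/funext => x; rewrite mul1r !indicE.
      have [Fx|Fx] := pselect (F j x).
        rewrite (mem_set Fx) [x \in U j.+1]mem_set; last by exists j => //=.
        rewrite memNset ?addr0// => -[i /= ij Fix].
        have := tF i j I I (ex_intro _ x (conj Fix Fx)) => e.
        by rewrite e ltnn in ij.
      rewrite (memNset Fx) add0r; congr (_%:R); congr nat_of_bool.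
      apply/idP/idP; rewrite !inE.
        move=> [i /=]; rewrite ltnS leq_eqVlt => /predU1P[-> //|ij Fix].
        by exists i.
      by move=> [i /= ij Fix]; exists i => //=; rewrite ltnS ltnW.
    by apply: weak_null_linear => //; exact: integrable_indic_fin.
  + have mi B : measurable B -> measurable_fun D (fun x => (\1_B x : R)%:E).
      move=> mB; apply/measurable_EFinP; apply: measurable_funTS.
      exact: measurable_indic.
    have [|||||_ + _] := @dominated_convergence _ _ _ m D mD
      (fun j x => (\1_(U j) x)%:E) (fun x => (\1_(\bigcup_k0 F k0) x)%:E)
      (fun=> 1%E).
    * by move=> j; exact: mi.
    * exact: mi.
    * apply: aeW => x Dx; apply: cvg_near_cst.
      have [[i _ Fix]|nU] := pselect ((\bigcup_k0 F k0) x).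
        near=> j; rewrite !indicE !mem_set//; first by exists i.
        by exists i => //=; near: j; exact: nbhs_infty_gt.
      near=> j; rewrite !indicE !memNset// => -[i _ Fix].
      by apply: nU; exists i.
    * exact: i1.
    * apply: aeW => x j Dx; rewrite /= lee_fin indicE.
      by case: (x \in _); rewrite ?normr1 ?normr0.
    apply: cvg_trans; apply: near_eq_cvg; near=> j.
    apply: eq_integral => x _.
    by rewrite -!EFinB !abse_EFin distrC.
Unshelve. all: by end_near. Qed.

(** Simple functions are dense in L^1. *)
Lemma weak_null_of_generator (G : set (set T)) :
  @measurable _ T = <<s G >> -> setI_closed G ->
  weak_null (fun=> 1) -> (forall A, G A -> weak_null \1_A) ->
  forall f, m.-integrable D (EFin \o f) -> weak_null f.
Proof.
move=> GE GI w1 wG f fi.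
have wA := weak_null_measurable G GE GI w1 wG.
have [g [gi _ gf]] := approximation_sfun_integrable mD fi.
apply: (weak_null_closed _ (fun j => g j)) => //.
by move=> j; exact: weak_null_sfun.
Qed.

End weak_null.
Arguments weak_null {d T R} m D k f.

(** * Oscillation along a line *)

(** In this section rho(t) = sqrt((t-y)^2 + c) is the distance from a fixed point
    to the point with parameter t of a line, and v, the derivative of the bounded
    function V, is evaluated at l rho(t) for large l.  The phase rho is
    smooth with nonzero derivative except at t = y. *)
Section oscillation.
Context {R : realType}.
Local Notation mu := (@lebesgue_measure R).
Variables (V v : R -> R) (C : R).
Hypothesis dV : forall s, is_derive s (1 : R) V (v s).
Hypothesis cv : continuous v.
Hypothesis VC : forall s, 0 <= s -> `|V s| <= C.
Hypothesis vC : forall s, 0 <= s -> `|v s| <= C.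
Variables (y c : R).
Hypothesis c0 : 0 <= c.
Implicit Types (t a b l : R).

Let rho t := Num.sqrt ((t - y) ^+ 2 + c).

Let rho_ge0 t : 0 <= rho t. Proof. exact: sqrtr_ge0. Qed.

Let rho_sqr t : rho t ^+ 2 = (t - y) ^+ 2 + c.
Proof. by rewrite sqr_sqrtr// addr_ge0// sqr_ge0. Qed.

Let rho_ge t : `|t - y| <= rho t.
Proof.
rewrite -sqrtr_sqr ler_wsqrtr// -[leLHS]addr0 lerD2l//.
Qed.

Let rho_le t : rho t <= `|t - y| + Num.sqrt c.
Proof.
rewrite -ler_sqr ?nnegrE ?addr_ge0 ?sqrtr_ge0// rho_sqr [leRHS]sqrrD real_normK ?num_real//.
by rewrite sqr_sqrtr// addrAC lerDl mulrn_wge0// mulr_ge0// sqrtr_ge0.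
Qed.

Let is_derive_rho t : t != y -> is_derive t (1 : R) rho ((t - y) / rho t).
Proof.
move=> ty.
have h0 : 0 < (t - y) ^+ 2 + c.
  by rewrite ltr_wpDr// lt0r sqr_ge0 sqrf_eq0 subr_eq0 ty.
have hs := is_derive1_sqrt h0.
have hi : is_derive t (1 : R) (fun t => (t - y) ^+ 2 + c) (2 * (t - y)).
  by derive_all => /=; ring.
have r0 : rho t != 0 by rewrite gt_eqF// sqrtr_gt0.
have h := @is_derive_chain R Num.sqrt (fun t => (t - y) ^+ 2 + c) t _ _ hs hi.
apply: is_derive_eq; rewrite -/(rho t); field.
by [].
Qed.

Let continuous_rho : continuous rho.
Proof.
move=> t; apply: (@continuous_cvg _ _ _ _ _ _ (@Num.sqrt R)).
  exact: sqrt_continuous.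
apply: cvgD; last exact: cvg_cst.
rewrite expr2; under eq_fun do rewrite expr2.
by apply: cvgM; (apply: cvgB; [exact: cvg_id|exact: cvg_cst]).
Qed.

Let k l t := v (l * rho t).

Let continuous_k l : continuous (k l).
Proof.
move=> t; apply: (@continuous_cvg _ _ _ _ _ _ v); first exact: cv.
by apply: cvgMr; exact: continuous_rho.
Qed.

(** H is the boundary term of the integration by parts of v(l rho) away from the
    critical point; w is the derivative of 1 / rho' = rho / (t - y). *)
Let w t := - (c / (rho t * (t - y) ^+ 2)).

Let H l t := V (l * rho t) * (rho t / (t - y)).

Let is_derive_H l t : t != y ->
  is_derive t (1 : R) (H l) (l * k l t + V (l * rho t) * w t).
Proof.
move=> ty; have hr := is_derive_rho t ty.
have ty0 : t - y != 0 by rewrite subr_eq0.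
have r0 : rho t != 0.
  by rewrite gt_eqF// (lt_le_trans _ (rho_ge t))// normr_gt0.
have hV : is_derive (l * rho t) (1 : R) V (v (l * rho t)) := dV _.
have hlr : is_derive t (1 : R) (fun t => l * rho t) (l * ((t - y) / rho t)).
  by derive_all => /=; rewrite mul0r add0r.
have hVl := @is_derive_chain R V (fun t => l * rho t) t _ _ hV hlr.
have hi : is_derive t (1 : R) (fun t => (t - y)^-1) (- (t - y) ^- 2).
  have h1 : is_derive t (1 : R) (fun t => t - y) 1.
    by derive_all => /=; ring.
  apply: DeriveDef; first exact: derivableV.
  by rewrite deriveV// derive_val /GRing.scale/= mulr1.
rewrite /H; derive_all => /=.
have cE : c = rho t ^+ 2 - (t - y) ^+ 2 by rewrite rho_sqr; ring.
rewrite /w [in RHS]cE /k; field.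
by rewrite r0 ty0.
Qed.

(** On an interval at a positive distance from y both the boundary term and the
    remaining integral are bounded, so the integral is O(1/l). *)
Let cvg_osc_itv a b (l : nat -> R) : (forall n, 0 < l n) ->
  l n @[n --> \oo] --> +oo -> a < b -> b < y \/ y < a ->
  \int[mu]_(t in `[a, b]) k (l n) t @[n --> \oo] --> (0 : R).
Proof.
move=> l0 loo ab yab.
have [e [e0 he]] : exists e, 0 < e /\ forall t, a <= t -> t <= b -> e <= `|t - y|.
  case: yab => h.
    exists (y - b); rewrite subr_gt0; split=> // t _ tb.
    by rewrite distrC ger0_norm ?subr_ge0 ?lerD2l ?lerN2// (le_trans tb)// ltW.
  exists (a - y); rewrite subr_gt0; split=> // t at_ _.
  by rewrite ger0_norm ?subr_ge0 ?lerD2r// (le_trans _ at_)// ltW.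
have ty t : a <= t -> t <= b -> t != y.
  by move=> h1 h2; rewrite -subr_eq0 -normr_gt0 (lt_le_trans e0)// he.
(* The first summand bounds the two boundary terms, as rho <= |t - y| + sqrt c. *)
pose K := 2 * (C * (1 + Num.sqrt c / e)) + C * (c / (e * e ^+ 2)) * (b - a).
suff hK n : `|\int[mu]_(t in `[a, b]) k (l n) t| <= K / l n.
  have Kl : K * (l n)^-1 @[n --> \oo] --> K * 0.
    apply: cvgMr; apply/(@gtr0_cvgV0 _ _ _ _ l); last exact: loo.
    exact: nearW.
  rewrite mulr0 in Kl.
  apply: (@squeeze_cvgr _ _ _ _ (fun n => - (K / l n)) (fun n => K / l n)).
  - by near=> n; rewrite -ler_norml.
  - by rewrite -[X in _ --> X]oppr0; apply: cvgN.
  - exact: Kl.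
have cIn (f : R -> R) : (forall t, a <= t -> t <= b -> {for t, continuous f}) ->
    {within `[a, b], continuous f}.
  move=> cf; apply: continuous_in_subspaceT => t; rewrite inE/= in_itv/= => /andP[].
  exact: cf.
have iIn (f : R -> R) : (forall t, a <= t -> t <= b -> {for t, continuous f}) ->
    mu.-integrable `[a, b] (EFin \o f).
  move=> cf; apply: continuous_compact_integrable; first exact: segment_compact.
  exact: cIn.
have cVr t : {for t, continuous (fun t => V (l n * rho t))}.
  apply: (@continuous_cvg _ _ _ _ _ _ V); first exact: is_derive_continuous (dV _).
  by apply: cvgMr; exact: continuous_rho.
have cw t : a <= t -> t <= b -> {for t, continuous w}.
  move=> h1 h2; apply: cvgN; apply: cvgMr; apply: cvgV.
    by rewrite mulf_neq0 ?expf_neq0 ?subr_eq0 ?ty// gt_eqF// (lt_le_trans e0)// (le_trans (he _ h1 h2)).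
  apply: cvgM; first exact: continuous_rho.
  rewrite expr2; under eq_fun do rewrite expr2.
  by apply: cvgM; (apply: cvgB; [exact: cvg_id|exact: cvg_cst]).
pose f t := l n * k (l n) t + V (l n * rho t) * w t.
have cf t : a <= t -> t <= b -> {for t, continuous f}.
  move=> h1 h2; apply: cvgD; first by apply: cvgMr; exact: continuous_k.
  by apply: cvgM; [exact: cVr|exact: cw].
have ik : mu.-integrable `[a, b] (EFin \o k (l n)).
  by apply: iIn => t _ _; exact: continuous_k.
have iVw : mu.-integrable `[a, b] (EFin \o (fun t => V (l n * rho t) * w t)).
  by apply: iIn => t h1 h2; apply: cvgM; [exact: cVr|exact: cw].
have dH t : a <= t -> t <= b -> is_derive t (1 : R) (H (l n)) (f t).
  by move=> h1 h2; exact: is_derive_H (ty _ h1 h2).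
have FTC : \int[mu]_(t in `[a, b]) f t = H (l n) b - H (l n) a.
  rewrite /Rintegral (@continuous_FTC2 R f (H (l n)) a b ab).
  - by [].
  - exact: cIn.
  - split.
    + move=> t; rewrite in_itv/= => /andP[h1 h2].
      by have [] := dH t (ltW h1) (ltW h2).
    + apply: cvg_at_right_filter.
      exact: is_derive_continuous (dH a (lexx _) (ltW ab)).
    + apply: cvg_at_left_filter.
      exact: is_derive_continuous (dH b (ltW ab) (lexx _)).
  - move=> t; rewrite in_itv/= => /andP[h1 h2].
    have h := dH t (ltW h1) (ltW h2).
    by rewrite derive1E derive_val.
have lr_ge0 t : 0 <= l n * rho t by rewrite mulr_ge0// ltW.
have HK t : a <= t -> t <= b -> `|H (l n) t| <= C * (1 + Num.sqrt c / e).
  move=> h1 h2; rewrite normrM ler_pM ?VC//.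
  rewrite normrM normfV (ger0_norm (rho_ge0 t)).
  have p0 : 0 < `|t - y| by rewrite (lt_le_trans e0) ?he.
  rewrite ler_pdivrMr// (le_trans (rho_le t))// mulrDl mul1r lerD2l.
  by rewrite mulrAC ler_pdivlMr// ler_wpM2l ?sqrtr_ge0 ?he.
have VwK : `|\int[mu]_(t in `[a, b]) (V (l n * rho t) * w t)| <=
    C * (c / (e * e ^+ 2)) * (b - a).
  apply: (le_trans (le_normr_Rintegral _ iVw)) => //.
  have -> : C * (c / (e * e ^+ 2)) * (b - a) =
      \int[mu]_(t in `[a, b]) (C * (c / (e * e ^+ 2))).
    have mab : mu `[a, b] = (b - a)%:E.
      by have := lebesgue_measure_itv `[a, b]; rewrite /= lte_fin ab -EFinB.
    rewrite Rintegral_cst//; congr (_ * _).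
    exact: (esym (congr1 fine mab)).
  apply: le_Rintegral => //.
  - exact: integrable_norm.
  - by apply: iIn => t _ _; exact: cvg_cst.
  move=> t /=; rewrite in_itv/= => /andP[h1 h2].
  have hw : `|w t| <= c / (e * e ^+ 2).
    rewrite normrN normrM (ger0_norm c0) ler_wpM2l// normfV.
    rewrite normrM (ger0_norm (rho_ge0 t)) normrX.
    have p0 : 0 < `|t - y| by rewrite (lt_le_trans e0) ?he.
    have q0 : 0 < rho t by rewrite (lt_le_trans p0).
    rewrite lef_pV2 ?posrE ?mulr_gt0 ?exprn_gt0//.
    apply: ler_pM.
    - exact: ltW.
    - by rewrite exprn_ge0// ltW.
    - by rewrite (le_trans (he _ h1 h2)).
    - rewrite lerXn2r ?nnegrE//; first exact: ltW.
      exact: he.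
  by rewrite normrM ler_pM ?VC.
rewrite ler_pdivlMr// mulrC -{1}(ger0_norm (ltW (l0 n))) -normrM -RintegralZl//.
have -> : \int[mu]_(t in `[a, b]) (l n * k (l n) t) =
   (H (l n) b - H (l n) a) - \int[mu]_(t in `[a, b]) (V (l n * rho t) * w t).
  rewrite -FTC -RintegralB//; last by apply: iIn.
  by apply: eq_Rintegral => t _; rewrite /f; ring.
apply: (le_trans (ler_normB _ _)); apply: lerD => //.
apply: (le_trans (ler_normB _ _)); rewrite mulr2n mulrDl !mul1r.
by apply: lerD; apply: HK => //; exact: ltW.
Unshelve. all: by end_near. Qed.

Section dilations.
Variable l : nat -> R.
Hypothesis l0 : forall n, 0 < l n.
Hypothesis loo : l n @[n --> \oo] --> +oo.

Let kl n : measurableTypeR R -> R := fun t => v (l n * rho t).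

Let kl_le n t : `|kl n t| <= C.
Proof. by apply: vC; rewrite mulr_ge0// ltW. Qed.

Let mkl (D : set (measurableTypeR R)) n : measurable_fun D (kl n).
Proof.
apply: measurable_funTS; apply: continuous_measurable_fun.
exact: continuous_k.
Qed.

(** Half-lines generate the Borel sets, and cut the interval into another interval
    that avoids y. *)
Let weak_null_itv a b (f : measurableTypeR R -> R) : a < b -> b < y \/ y < a ->
  mu.-integrable `[a, b] (EFin \o f) -> weak_null mu `[a, b] kl f.
Proof.
move=> ab yab fi.
have mD : measurable (`[a, b] : set (measurableTypeR R)) by [].
have Dfin : (mu (`[a, b] : set (measurableTypeR R)) < +oo)%E.
  have -> : mu (`[a, b] : set (measurableTypeR R)) = (b - a)%:E.
    by have := lebesgue_measure_itv `[a, b]; rewrite /= lte_fin ab -EFinB.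
  by rewrite ltry.
have h := weak_null_of_generator _ _ _ mu _ mD kl C (mkl _) (fun n t _ => kl_le n t) Dfin
  (@RGenCInfty.G R).
apply: h => //.
- exact: RGenCInfty.measurableE.
- move=> _ _ [x1 ->] [x2 ->]; exists (Num.max x1 x2).
  by apply/seteqP; split => t /=; rewrite !in_itv/= !andbT ge_max => /andP.
- rewrite /weak_null; under eq_fun do under eq_Rintegral do rewrite mul1r.
  exact: cvg_osc_itv.
- move=> _ [x ->]; rewrite /weak_null.
  have -> : (fun n => \int[mu]_(t in `[a, b]) (\1_(`[x, +oo[) t * kl n t)) =
      (fun n => \int[mu]_(t in `[Num.max a x, b]) kl n t).
    apply/funext => n.
    have -> : `[Num.max a x, b]%classic = `[a, b] `&` `[x, +oo[ :> set (measurableTypeR R).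
      apply/seteqP; split => t /=; rewrite !in_itv/= andbT ge_max.
        by move=> /andP[/andP[-> ->] ->].
      by move=> [/andP[-> ->] ->].
    rewrite Rintegral_mkcondr; apply: eq_Rintegral => t _.
    by rewrite patchE indicE; case: ifP => _; rewrite ?mul1r ?mul0r.
  have [xb|bx] := ltP (Num.max a x) b.
    apply: cvg_osc_itv => //.
    by case: yab => h; [left|right; rewrite lt_max h].
  apply: cvg_near_cst; near=> n.
  have [e|ne] := eqVneq (Num.max a x) b.
    by rewrite e set_itv1 Rintegral_set1.
  by rewrite set_itv_ge ?Rintegral_set0// bnd_simp -ltNge lt_neqAle eq_sym ne.
Unshelve. all: by end_near. Qed.

Let weak_null_restrict (A : set (measurableTypeR R)) (f : measurableTypeR R -> R) :
  measurable A -> weak_null mu A kl f -> weak_null mu setT kl (fun t => f t * \1_A t).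
Proof.
move=> mA; rewrite /weak_null.
have -> // : (fun n => \int[mu]_t (f t * \1_A t * kl n t)) =
  (fun n => \int[mu]_(t in A) (f t * kl n t)).
apply/funext => n; rewrite [RHS]Rintegral_mkcond; apply: eq_Rintegral => t _.
by rewrite patchE indicE; case: ifP => _; rewrite ?mulr1 ?mulr0 ?mul0r.
Qed.

Let indic_window (t J u : R) : 0 < u -> u <= `|t - y| -> `|t - y| <= J ->
  \1_(`[y - J, y - u]) t + \1_(`[y + u, y + J]) t = 1 :> R.
Proof.
move=> u0 j3 j2; rewrite !indicE !mem_setE !in_itv/=.
have [h|h] := ltP t y.
  move: j2 j3; rewrite ltr0_norm ?subr_lt0// => j2 j3.
  have -> : y - J <= t by lra.
  have -> : t <= y - u by lra.
  have -> : (y + u <= t) = false by apply/negbTE; rewrite -ltNge; lra.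
  by rewrite addr0.
move: j2 j3; rewrite ger0_norm ?subr_ge0// => j2 j3.
have -> : (t <= y - u) = false by apply/negbTE; rewrite -ltNge; lra.
have -> : y + u <= t by lra.
have -> : t <= y + J by lra.
by rewrite andbF add0r.
Qed.

(** An integrable f is the limit in L^1 of its restrictions to two intervals on
    either side of y that exhaust the complement of y. *)
Lemma weak_null_oscillation (f : measurableTypeR R -> R) :
  mu.-integrable setT (EFin \o f) ->
  weak_null mu setT (fun n t => v (l n * Num.sqrt ((t - y) ^+ 2 + c))) f.
Proof.
move=> fi.
pose A j : set (measurableTypeR R) := `[y - j.+2%:R, y - j.+2%:R^-1]%classic.
pose B j : set (measurableTypeR R) := `[y + j.+2%:R^-1, y + j.+2%:R]%classic.
have mA j : measurable (A j) by exact: measurable_itv.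
have mB j : measurable (B j) by exact: measurable_itv.
have j1 j : (j.+2%:R^-1 : R) < j.+2%:R.
  by rewrite (@lt_trans _ _ 1)// ?invf_lt1// ltr1n.
have wA j : weak_null mu setT kl (fun t => f t * \1_(A j) t).
  apply: weak_null_restrict => //; apply: weak_null_itv.
  - by rewrite ltrD2l ltrN2.
  - by left; rewrite gtrDl oppr_lt0 invr_gt0.
  - by apply: integrableS fi.
have wB j : weak_null mu setT kl (fun t => f t * \1_(B j) t).
  apply: weak_null_restrict => //; apply: weak_null_itv.
  - by rewrite ltrD2l.
  - by right; rewrite ltrDl invr_gt0.
  - by apply: integrableS fi.
have indI D : measurable D -> mu.-integrable setT (EFin \o (fun t => f t * \1_D t)).
  move=> mD; apply: (le_integrable _ _ _ fi) => //.
    apply/measurable_EFinP; apply: measurable_funM; last exact: measurable_indic.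
    by apply/measurable_EFinP; exact: measurable_int fi.
  move=> t _; rewrite /= lee_fin normrM indicE.
  by case: (t \in D); rewrite ?normr1 ?normr0 ?mulr1 ?mulr0.
(* The factor 1 matches the shape of linear combinations in weak_null_linear. *)
pose g j t := 1 * (f t * \1_(A j) t) + f t * \1_(B j) t.
have gi j : mu.-integrable setT (EFin \o g j).
  have := integrableD measurableT (indI _ (mA j)) (indI _ (mB j)).
  by apply: eq_integrable => // t _; rewrite /= /g mul1r EFinD.
apply: (weak_null_closed _ _ _ mu setT measurableT kl C (mkl _) (fun n t _ => kl_le n t) f g) => //.
  move=> j; apply: (weak_null_linear _ _ _ mu setT measurableT kl C (mkl _)
    (fun n t _ => kl_le n t) _ _ _ (indI _ (mA j)) (indI _ (mB j)) (wA j) (wB j)).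
have gfE j t : g j t = f t * (\1_(A j) t + \1_(B j) t) by rewrite /g; ring.
have disj j t : \1_(A j) t + \1_(B j) t = 0 :> R \/ \1_(A j) t + \1_(B j) t = 1 :> R.
  rewrite !indicE /A /B !mem_setE !in_itv/=.
  have : 0 < (j.+2%:R^-1 : R) by rewrite invr_gt0.
  generalize (j.+2%:R^-1 : R) (j.+2%:R : R) => u J u0.
  have [h|h] := boolP (t <= y - u).
    have -> : (y + u <= t) = false by apply/negbTE; rewrite -ltNge; lra.
    by rewrite addr0 andbT; case: (_ <= _); [right|left].
  by rewrite andbF add0r; case: (_ && _); [right|left].
have [|||||_ + _] := @dominated_convergence _ _ _ mu setT measurableT
    (fun j t => (g j t)%:E) (EFin \o f) (fun t => `|f t|%:E).
- by move=> j; exact: measurable_int (gi j).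
- exact: measurable_int fi.
- exists [set y]; split => //; first exact: lebesgue_measure_set1.
  move=> t /= h; apply: contrapT => ty; apply: h => _.
  apply: cvg_near_cst.
  have ty0 : 0 < `|t - y| by rewrite normr_gt0 subr_eq0; apply/eqP.
  near=> j; rewrite gfE (_ : _ + _ = 1) ?mulr1//.
  have j2 : `|t - y| <= j.+2%:R.
    have : `|t - y| <= j%:R by near: j; exact: nbhs_infty_ger.
    by move=> /le_trans; apply; rewrite ler_nat ltnW.
  have j3 : j.+2%:R^-1 <= `|t - y|.
    rewrite invf_ple ?posrE//.
    have : `|t - y|^-1 <= j%:R by near: j; exact: nbhs_infty_ger.
    by move=> /le_trans; apply; rewrite ler_nat ltnW.
  by apply: indic_window => //; rewrite invr_gt0.
- exact: integrable_norm.
- apply: aeW => t j _; rewrite /= lee_fin gfE normrM.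
  by have [->|->] := disj j t; rewrite ?normr0 ?normr1 ?mulr0 ?mulr1.
apply: cvg_trans; apply: near_eq_cvg; near=> j.
apply: eq_integral => t _.
change (`|(g j t)%:E - (f t)%:E| = `|(f t)%:E - (g j t)%:E|)%E.
by rewrite -!EFinB !abse_EFin distrC.
Unshelve. all: by end_near. Qed.

End dilations.

End oscillation.

(** * Lifting to products and to Euclidean space *)

Section weak_null_prod.
Context d1 d2 (T1 : measurableType d1) (T2 : measurableType d2) (R : realType).
Variable m1 : {sigma_finite_measure set T1 -> \bar R}.
Variable m2 : {sigma_finite_measure set T2 -> \bar R}.
Variables (k : nat -> T1 * T2 -> R) (C : R).
Hypothesis mk : forall n, measurable_fun setT (k n).
Hypothesis kC : forall n z, `|k n z| <= C.
Hypothesis wk : forall y (g : T1 -> R), m1.-integrable setT (EFin \o g) ->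
  weak_null m1 setT (fun n x => k n (x, y)) g.

(** By Fubini and dominated convergence it is enough to have the property in the
    first variable, for each value of the second. *)
Lemma weak_null_prod (f : T1 * T2 -> R) :
  (m1 \x m2)%E.-integrable setT (EFin \o f) -> weak_null (m1 \x m2)%E setT k f.
Proof.
move=> fi.
have Fi n := integrable_mul _ _ _ (m1 \x m2)%E setT measurableT k C mk
  (fun n z _ => kC n z) f n fi.
pose G n y := (\int[m1]_x (f (x, y) * k n (x, y))%:E)%E.
have GE n : (\int[m1 \x m2]_z (f z * k n z)%:E = \int[m2]_y G n y)%E.
  by rewrite -(@integral21_prod_meas1 _ _ _ _ _ m1 m2 _ (Fi n)).
have mG n : measurable_fun setT (G n).
  exact: (@measurable_fubini_G _ _ _ _ _ m1 m2 _ (Fi n)).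
have fn : (m1 \x m2)%E.-integrable setT (fun z => (`|C| * `|f z|)%:E).
  have := integrableZl measurableT `|C| (integrable_norm fi).
  by apply: eq_integrable => // z _; rewrite EFinM.
have ig : m2.-integrable setT (fun y => \int[m1]_x (`|C| * `|f (x, y)|)%:E)%E.
  apply/integrableP; split; first exact: (@measurable_fubini_G _ _ _ _ _ m1 m2 _ fn).
  have mfn := measurable_int _ fn.
  apply: le_lt_trans ((@integrable21ltyP _ _ _ _ _ m1 m2 _ mfn).1 fn).
  rewrite le_eqVlt; apply/orP; left; apply/eqP; apply: eq_integral => y _.
  rewrite gee0_abs; last first.
    by apply: integral_ge0 => x _; rewrite lee_fin mulr_ge0.
  by apply: eq_integral => x _; rewrite gee0_abs// lee_fin mulr_ge0.
have aef := @ae_integrable2 _ _ _ _ _ m1 m2 _ fi.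
have aen := @ae_integrable2 _ _ _ _ _ m1 m2 _ fn.
have aeF n := @ae_integrable2 _ _ _ _ _ m1 m2 _ (Fi n).
have mky n y : measurable_fun setT (fun x => k n (x, y)).
  by apply: measurableT_comp (mk n) _; exact: pair2_measurable.
have [|||||_ _] := @dominated_convergence _ _ _ m2 setT measurableT
    G (fun=> 0%E) (fun y => \int[m1]_x (`|C| * `|f (x, y)|)%:E)%E.
- exact: mG.
- exact: measurable_cst.
- apply: filterS aef => y fy _.
  have fy' : m1.-integrable setT (EFin \o (fun x => f (x, y))) by [].
  have := wk y _ fy'; rewrite /weak_null /Rintegral => h.
  apply/fine_cvgP; split; last exact: h.
  apply: nearW => n; apply: (integrable_fin_num measurableT).
  exact: (integrable_mul _ _ _ m1 setT measurableT (fun n x => k n (x, y)) C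
    (fun n => mky n y) (fun n x _ => kC n (x, y)) _ n fy').
- exact: ig.
- apply: filterS2 aef aen => y fy ny n _.
  have fy' : m1.-integrable setT (EFin \o (fun x => f (x, y))) by [].
  have iFy := integrable_mul _ _ _ m1 setT measurableT (fun n x => k n (x, y)) C
    (fun n => mky n y) (fun n x _ => kC n (x, y)) _ n fy'.
  apply: (le_trans (le_abse_integral m1 measurableT _)).
    exact: measurable_int iFy.
  apply: ge0_le_integral => //.
  + by apply: measurableT_comp => //; exact: measurable_int iFy.
  + exact: measurable_int ny.
  + move=> x _; rewrite lee_fin normrM mulrC ler_wpM2r//.
    by apply: le_trans (ler_norm C); exact: kC.
rewrite integral0 => h.
rewrite /weak_null /Rintegral; under eq_fun do rewrite GE.
by have /fine_cvgP[] := h.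
Qed.

End weak_null_prod.

Section euclidean_oscillation.
Context {R : realType}.
Variables (V v : R -> R) (C : R).
Hypothesis dV : forall s, is_derive s (1 : R) V (v s).
Hypothesis cv : continuous v.
Hypothesis VC : forall s, 0 <= s -> `|V s| <= C.
Hypothesis vC : forall s, 0 <= s -> `|v s| <= C.
Variable l : nat -> R.
Hypothesis l0 : forall n, 0 < l n.
Hypothesis loo : l n @[n --> \oo] --> +oo.

Lemma measurable_euclidean_dist d :
  measurable_fun setT (fun z : euclidean R d * euclidean R d => Defs.edist z.1 z.2).
Proof.
apply: (measurableT_comp (f := @Num.sqrt R)).
  apply: continuous_measurable_fun; exact: sqrt_continuous.
apply: measurable_sum => i; apply: measurable_funX; apply: measurable_funB.
  exact: (measurableT_comp (measurable_tnth i) measurable_fst).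
exact: (measurableT_comp (measurable_tnth i) measurable_snd).
Qed.

Lemma measurable_euclidean_dist_left d (y : euclidean R d) :
  measurable_fun setT (fun x : euclidean R d => Defs.edist x y).
Proof.
apply: (measurableT_comp
  (f := fun z : euclidean R d * euclidean R d => Defs.edist z.1 z.2)
  (g := fun x => (x, y))); first exact: measurable_euclidean_dist.
exact: pair2_measurable.
Qed.

Let measurable_v : measurable_fun setT v.
Proof. exact: continuous_measurable_fun. Qed.

Lemma euclidean_dist_econs d (t : R) (x : euclidean R d) (y : euclidean R d.+1) :
  Defs.edist (econs (t, x)) y =
  Num.sqrt ((t - tnth y ord0) ^+ 2 +
    \sum_(i < d) ((tnth x i : R) - (tnth y (lift ord0 i) : R)) ^+ 2).
Proof.
rewrite /Defs.edist big_ord_recl; congr (Num.sqrt (_ + _)).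
by apply: eq_bigr => i _; rewrite [in LHS]/econs tnthS.
Qed.

Lemma integrable_econs d (g : euclidean R d.+1 -> \bar R) :
  (lebesgue_euclidean R d.+1).-integrable setT g ->
  (product_measure1 (@lebesgue_measure R) (lebesgue_euclidean R d)).-integrable setT
    (g \o econs).
Proof.
move=> /integrableP[mg gi]; apply/integrableP; split.
  by apply: measurableT_comp mg _; exact: measurable_econs.
apply: le_lt_trans gi; rewrite le_eqVlt; apply/orP; left; apply/eqP/esym.
apply: (@ge0_integral_pushforward _ _ _ _ R econs (@measurable_econs R d)
  (product_measure1 (@lebesgue_measure R) (lebesgue_euclidean R d)) setT
  (abse \o g)) => //.
  exact: measurableT_comp.
by move=> y _; exact: abse_ge0.
Qed.

Lemma integral_econs d (g : euclidean R d.+1 -> \bar R) :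
  (lebesgue_euclidean R d.+1).-integrable setT g ->
  (\int[lebesgue_euclidean R d.+1]_x g x =
  \int[product_measure1 (@lebesgue_measure R) (lebesgue_euclidean R d)]_z g (econs z))%E.
Proof.
move=> gi.
apply: (@integral_pushforward _ _ _ _ R econs (@measurable_econs R d)
  (product_measure1 (@lebesgue_measure R) (lebesgue_euclidean R d)) setT g) => //.
  exact: measurable_int gi.
exact: integrable_econs.
Qed.

(** The first coordinate is enough: with the other coordinates of x fixed, the
    point moves on a line. *)
Lemma weak_null_euclidean d (y : euclidean R d.+1) (f : euclidean R d.+1 -> R) :
  (lebesgue_euclidean R d.+1).-integrable setT (EFin \o f) ->
  weak_null (lebesgue_euclidean R d.+1) setT (fun n x => v (l n * Defs.edist x y)) f.
Proof.
move=> fi.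
have kC n (x : euclidean R d.+1) : `|v (l n * Defs.edist x y)| <= C.
  apply: vC; apply: mulr_ge0; [exact: ltW|exact: euclidean_dist_ge0].
have mk n : measurable_fun setT (fun x : euclidean R d.+1 => v (l n * Defs.edist x y)).
  apply: measurableT_comp => //; apply: measurable_funM => //.
  exact: measurable_euclidean_dist_left.
have h : weak_null (product_measure1 (@lebesgue_measure R) (lebesgue_euclidean R d)) setT
    (fun n z => v (l n * Defs.edist (econs z) y)) (f \o econs).
  apply: (weak_null_prod _ _ _ _ _ _ _ _ C).
  - by move=> n; exact: measurableT_comp (mk n) (@measurable_econs R d).
  - by move=> n z; exact: kC.
  - move=> x g gi.
    have := @weak_null_oscillation R V v C dV cv VC vC (tnth y ord0)
      (\sum_(i < d) ((tnth x i : R) - (tnth y (lift ord0 i) : R)) ^+ 2) _ l l0 loo g gi.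
    have c0 : 0 <= \sum_(i < d) ((tnth x i : R) - (tnth y (lift ord0 i) : R)) ^+ 2.
      by apply: sumr_ge0 => i _; exact: sqr_ge0.
    move=> /(_ c0); rewrite /weak_null; apply: cvg_trans; apply: near_eq_cvg.
    apply: nearW => n; apply: eq_Rintegral => t _.
    by rewrite euclidean_dist_econs.
  - exact: integrable_econs fi.
move: h; rewrite /weak_null; apply: cvg_trans; apply: near_eq_cvg.
apply: nearW => n; rewrite /Rintegral integral_econs//.
exact: (integrable_mul _ _ _ (lebesgue_euclidean R d.+1) setT measurableT _ C mk
  (fun n x _ => kC n x) f n fi).
Qed.

Lemma weak_null_euclidean_pairs d (f : euclidean R d.+1 * euclidean R d.+1 -> R) :
  (lebesgue_euclidean R d.+1 \x lebesgue_euclidean R d.+1)%E.-integrable setT (EFin \o f) ->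
  weak_null (lebesgue_euclidean R d.+1 \x lebesgue_euclidean R d.+1)%E setT
    (fun n z => v (l n * Defs.edist z.1 z.2)) f.
Proof.
apply: (weak_null_prod _ _ _ _ _ _ _ _ C) => //.
- move=> n; apply: measurableT_comp => //; apply: measurable_funM => //.
  exact: measurable_euclidean_dist.
- by move=> n z; apply: vC; apply: mulr_ge0; [exact: ltW|exact: euclidean_dist_ge0].
- by move=> y g; exact: weak_null_euclidean.
Qed.

End euclidean_oscillation.

(** * Averaging a radial profile *)

(** The profile g tends to M at infinity up to a part v whose dilates average to
    zero, so g(l r) acts as the constant M in the limit. *)
Section radial_average.
Context d (T : measurableType d) (R : realType).
Variable m : {measure set T -> \bar R}.
Variables (r : T -> R) (l : nat -> R) (g v : R -> R) (C M : R).
Hypothesis mr : measurable_fun setT r.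
Hypothesis r0 : forall z, 0 <= r z.
Hypothesis l0 : forall n, 0 < l n.
Hypothesis loo : l n @[n --> \oo] --> +oo.
Hypothesis cg : continuous g.
Hypothesis cv : continuous v.
Hypothesis gC : forall s, 0 <= s -> `|g s| <= C.
Hypothesis vC : forall s, 0 <= s -> `|v s| <= C.
Hypothesis g0 : forall s, 0 <= s -> 0 <= g s.
Hypothesis gvM : g s - v s @[s --> +oo] --> M.
Hypothesis M0 : 0 < M.
Hypothesis wv : forall F : T -> R, m.-integrable setT (EFin \o F) ->
  weak_null m setT (fun n z => v (l n * r z)) F.

Let lr0 n z : 0 <= l n * r z. Proof. by apply: mulr_ge0 => //; exact: ltW. Qed.

Let mk (h : R -> R) n : continuous h -> measurable_fun setT (fun z => h (l n * r z)).
Proof.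
move=> ch; apply: (measurableT_comp (f := h)).
  exact: continuous_measurable_fun.
by apply: measurable_funM.
Qed.

(** What remains after the oscillating part v and the mean M are removed tends to
    zero pointwise off the set r = 0, where F vanishes. *)
Lemma radial_average_integrable (F : T -> R) :
  m.-integrable setT (EFin \o F) -> (forall z, r z = 0 -> F z = 0) ->
  \int[m]_z (F z * g (l n * r z)) @[n --> \oo] --> M * \int[m]_z F z.
Proof.
move=> Fi F0.
have Fg n := integrable_mul _ _ _ m setT measurableT (fun n z => g (l n * r z)) C
  (fun n => mk g n cg) (fun n z _ => gC _ (lr0 n z)) F n Fi.
have Fv n := integrable_mul _ _ _ m setT measurableT (fun n z => v (l n * r z)) C
  (fun n => mk v n cv) (fun n z _ => vC _ (lr0 n z)) F n Fi.
pose h s := g s - v s - M.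
have MF : m.-integrable setT (EFin \o (fun z => M * F z)).
  have := integrableZl measurableT M Fi.
  by apply: eq_integrable => // z _; rewrite /= EFinM.
have Fh n : m.-integrable setT (EFin \o (fun z => F z * h (l n * r z))).
  have := integrableB measurableT (integrableB measurableT (Fg n) (Fv n)) MF.
  by apply: eq_integrable => // z _; rewrite /= -!EFinB /h; congr EFin; ring.
have cvh : \int[m]_z (F z * h (l n * r z)) @[n --> \oo] --> (0 : R).
  have [|||||_ _] := @dominated_convergence _ _ _ m setT measurableT
    (fun n z => (F z * h (l n * r z))%:E) (fun=> 0%E)
    (fun z => (`|C + C + M| * `|F z|)%:E).
  - by move=> n; exact: measurable_int (Fh n).
  - exact: measurable_cst.
  - apply: aeW => z _.
    have [rz|rz] := eqVneq (r z) 0.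
      rewrite F0//; apply: cvg_near_cst; apply: nearW => n.
      by rewrite mul0r.
    have rz0 : 0 < r z by rewrite lt_neqAle eq_sym rz r0.
    apply/fine_cvgP; split; first exact: nearW.
    have lrz : l n * r z @[n --> \oo] --> +oo.
      apply/cvgryPge => A; have /cvgryPge/(_ (A / r z)) := loo.
      by apply: filterS => n; rewrite ler_pdivrMr.
    have hz : h (l n * r z) @[n --> \oo] --> M - M.
      apply: cvgB; last exact: cvg_cst.
      exact: (cvg_comp _ _ lrz gvM).
    rewrite subrr in hz; rewrite -[X in _ --> X](mulr0 (F z)).
    exact: cvgMr.
  - have := integrableZl measurableT `|C + C + M| (integrable_norm Fi).
    by apply: eq_integrable => // z _; rewrite /= EFinM.
  - apply: aeW => z n _; rewrite /= lee_fin normrM mulrC ler_wpM2r//.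
    rewrite /h; apply: le_trans (ler_norm _).
    apply: (le_trans (ler_normB _ _)); rewrite (gtr0_norm M0) lerD2r.
    apply: (le_trans (ler_normB _ _)); apply: lerD; [exact: gC|exact: vC].
  by rewrite integral0 => /fine_cvgP[].
have -> : (fun n => \int[m]_z (F z * g (l n * r z))) = (fun n =>
    \int[m]_z (F z * h (l n * r z)) + \int[m]_z (F z * v (l n * r z)) +
    M * \int[m]_z F z).
  apply/funext => n.
  have Fhv : m.-integrable setT
      (EFin \o (fun z => F z * h (l n * r z) + F z * v (l n * r z))).
    have := integrableD measurableT (Fh n) (Fv n).
    by apply: eq_integrable => // z _; rewrite /= EFinD.
  rewrite -(RintegralZl M measurableT Fi) -(RintegralD measurableT (Fh n) (Fv n)).
  rewrite -(RintegralD measurableT Fhv MF).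
  by apply: eq_Rintegral => z _; rewrite /h; ring.
rewrite -[X in _ --> X]add0r -[X in _ --> X + _](addr0 0).
apply: cvgD; last exact: cvg_cst.
by apply: cvgD; [exact: cvh|exact: wv].
Qed.

Hypothesis sf : exists B : nat -> set T, [/\ setT = \bigcup_i B i,
  nondecreasing_seq B & forall i, measurable (B i) /\ (m (B i) < +oo)%E].

(** If F has infinite integral, truncations H j of F by height j and by sets B j of
    finite measure have arbitrarily large integral, and the nonnegativity of g lets
    them bound the integral for F from below. *)
Lemma radial_average (F : T -> R) : measurable_fun setT F ->
  (forall z, 0 <= F z) -> (forall z, r z = 0 -> F z = 0) ->
  (\int[m]_z (F z * g (l n * r z))%:E @[n --> \oo] --> M%:E * \int[m]_z (F z)%:E)%E.
Proof.
move=> mF F_ge0 F0.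
have Fg_ge0 n z : 0 <= F z * g (l n * r z) by rewrite mulr_ge0// g0.
have mFg n : measurable_fun setT (fun z => (F z * g (l n * r z))%:E).
  by apply/measurable_EFinP; apply: measurable_funM => //; exact: mk.
have fin_case (H : T -> R) : m.-integrable setT (EFin \o H) ->
    (forall z, r z = 0 -> H z = 0) ->
    (\int[m]_z (H z * g (l n * r z))%:E @[n --> \oo] --> (M * \int[m]_z H z)%:E)%E.
  move=> Hi H0; have hc := radial_average_integrable H Hi H0.
  apply/fine_cvgP; split; last exact: hc.
  apply: nearW => n; apply: (integrable_fin_num measurableT).
  exact: (integrable_mul _ _ _ m setT measurableT (fun n z => g (l n * r z)) C
    (fun n => mk g n cg) (fun n z _ => gC _ (lr0 n z)) H n Hi).
have [Foo|Foo] := ltP (\int[m]_z (F z)%:E)%E +oo%E.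
  have Fi : m.-integrable setT (EFin \o F).
    apply/integrableP; split; first exact/measurable_EFinP.
    by under eq_integral do rewrite /= ger0_norm//.
  have := fin_case F Fi F0.
  rewrite /Rintegral EFinM fineK//.
  exact: (integrable_fin_num measurableT Fi).
have -> : (\int[m]_z (F z)%:E = +oo)%E by apply/eqP; rewrite -leye_eq.
rewrite gt0_muley ?lte_fin//.
have [B [BT ndB Bfin]] := sf.
pose H j z := Num.min (F z) j%:R * \1_(B j) z.
have H_ge0 j z : 0 <= H j z by rewrite mulr_ge0// le_min F_ge0/=.
have H_le j z : H j z <= F z.
  rewrite /H indicE; case: (_ \in _); rewrite ?mulr1 ?mulr0 ?F_ge0//.
  by rewrite ge_min lexx.
have H0 j z : r z = 0 -> H j z = 0.
  by move=> rz; apply/eqP; rewrite eq_le H_ge0 andbT -(F0 z rz) H_le.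
have mH j : measurable_fun setT (H j).
  apply: measurable_funM; last by apply: measurable_indic; exact: (Bfin j).1.
  by apply: measurable_minr => //; exact: measurable_cst.
have Hi j : m.-integrable setT (EFin \o H j).
  apply/integrableP; split; first exact/measurable_EFinP.
  apply: (@le_lt_trans _ _ (\int[m]_z (j%:R%:E * (\1_(B j) z)%:E))%E).
    apply: ge0_le_integral => //.
    - by apply: measurableT_comp => //; exact/measurable_EFinP.
    - apply: emeasurable_funM; first exact: measurable_cst.
      by apply/measurable_EFinP; apply: measurable_indic; exact: (Bfin j).1.
    move=> z _; rewrite /= ger0_norm// -EFinM lee_fin ler_wpM2r//.
    by rewrite ge_min lexx orbT.
  rewrite ge0_integralZl//; last first.
    by apply/measurable_EFinP; apply: measurable_indic; exact: (Bfin j).1.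
  rewrite integral_indic//; last exact: (Bfin j).1.
  by rewrite setIT lte_mul_pinfty// (Bfin j).2.
have HF : (\int[m]_z (H j z)%:E @[j --> \oo] --> \int[m]_z (F z)%:E)%E.
  have -> : (\int[m]_z (F z)%:E = \int[m]_z (limn (fun j => (H j z)%:E)))%E.
    apply: eq_integral => z _; apply/esym/cvg_lim => //.
    have [i _ Biz] : (\bigcup_i B i) z by rewrite -BT.
    apply: cvg_near_cst; near=> j; congr EFin; rewrite /H.
    have Bjz : B j z.
      have ij : (i <= j)%N by near: j; exact: nbhs_infty_ge.
      by have /subsetPset := ndB _ _ ij; apply.
    rewrite indicE mem_set// mulr1 min_l//.
    by near: j; exact: nbhs_infty_ger.
  apply: cvg_monotone_convergence => //.
  - by move=> j; exact/measurable_EFinP.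
  - by move=> j z _; rewrite lee_fin.
  - move=> z _ i j ij; rewrite lee_fin /H; apply: ler_pM => //.
    + by rewrite le_min F_ge0/=.
    + by rewrite le_min !ge_min lexx/= ler_nat ij orbT.
    rewrite !indicE ler_nat; have [zi|] := boolP (z \in B i) => //.
    rewrite [z \in B j]mem_set//; move: zi; rewrite inE.
    by have /subsetPset := ndB _ _ ij; apply.
have intFoo : (\int[m]_z (F z)%:E = +oo)%E by apply/eqP; rewrite -leye_eq.
rewrite intFoo in HF.
apply/cvgeyPge => A.
have /cvgeyPge/(_ ((A + 1) / M)) HA := HF.
near \oo => j.
have HAj : (((A + 1) / M)%:E <= \int[m]_z (H j z)%:E)%E by near: j.
have Hlim := radial_average_integrable (H j) (Hi j) (H0 j).
have AH : A < M * \int[m]_z H j z.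
  apply: (@lt_le_trans _ _ (A + 1)); first by rewrite ltrDl.
  rewrite mulrC -ler_pdivrMr// -lee_fin /Rintegral fineK//.
  exact: (integrable_fin_num measurableT (Hi j)).
have : \forall n \near \oo, A < \int[m]_z (H j z * g (l n * r z)).
  exact: (cvgr_gt _ Hlim _ AH).
apply: filterS => n An.
have HgE : (\int[m]_z (H j z * g (l n * r z))%:E =
    (\int[m]_z (H j z * g (l n * r z)))%:E)%E.
  rewrite /Rintegral fineK//; apply: (integrable_fin_num measurableT).
  exact: (integrable_mul _ _ _ m setT measurableT (fun n z => g (l n * r z)) C
    (fun n => mk g n cg) (fun n z _ => gC _ (lr0 n z)) (H j) n (Hi j)).
apply: (@le_trans _ _ (\int[m]_z (H j z * g (l n * r z))%:E)%E).
  by rewrite HgE lee_fin ltW.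
apply: ge0_le_integral => //.
- by move=> z _; rewrite lee_fin mulr_ge0// g0.
- by apply/measurable_EFinP; apply: measurable_funM => //; exact: mk.
- by move=> z _; rewrite lee_fin ler_wpM2r// g0.
Unshelve. all: by end_near. Qed.

End radial_average.

(** * The variance *)

Section variance.
Context {R : realType}.

Definition gagliardo_weight d (f : euclidean R d -> R)
    (z : euclidean R d * euclidean R d) : R :=
  `|f z.1 - f z.2| ^+ 2 / Defs.edist z.1 z.2 ^+ d.+1.

Lemma gagliardo_weight_ge0 d f z : 0 <= @gagliardo_weight d f z.
Proof. by rewrite divr_ge0// exprn_ge0// euclidean_dist_ge0. Qed.

Lemma measurable_gagliardo_weight d (f : euclidean R d -> R) :
  measurable_fun setT f -> measurable_fun setT (gagliardo_weight d f).
Proof.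
move=> mf; apply: measurable_funM.
  apply: measurable_funX; apply: measurableT_comp => //.
  apply: measurable_funB.
    exact: measurableT_comp mf measurable_fst.
  exact: measurableT_comp mf measurable_snd.
have -> : (fun z : euclidean R d * euclidean R d => (Defs.edist z.1 z.2 ^+ d.+1)^-1) =
    (fun z => (Defs.edist z.1 z.2 ^+ d.+1) `^ (-1)).
  by apply/funext => z; rewrite powR_inv1// exprn_ge0// euclidean_dist_ge0.
apply: (measurableT_comp (f := fun x : R => x `^ (-1))).
  exact: measurable_powR.
by apply: measurable_funX; exact: measurable_euclidean_dist.
Qed.

Lemma euclidean_dist_eq0 d (x y : euclidean R d) : Defs.edist x y = 0 -> x = y.
Proof.
by have [//|/euclidean_dist_gt0] := eqVneq x y; move=> + e; rewrite e ltxx.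
Qed.

(** Twice the profile is [energy] + [osc]. *)
Definition profile d (s : R) : R := s ^+ d.+1 * phi d s ^+ 2.

Lemma continuous_profile d : continuous (profile d).
Proof.
move=> s; have h := is_derive_phi d s.
have [df hd] : exists df, is_derive s (1 : R) (profile d) df.
  by eexists; rewrite /profile; repeat derive_rule.
exact: is_derive_continuous hd.
Qed.

Lemma continuous_osc d : continuous (osc d : R -> R).
Proof.
move=> s; have h := is_derive_phi d s; have h' := is_derive_dphi d s.
have [df hd] : exists df, is_derive s (1 : R) (osc d) df.
  by eexists; rewrite /osc; repeat derive_rule.
exact: is_derive_continuous hd.
Qed.

(** Both integrands vanish on the diagonal, where the weight is 0/0 = 0. *)
Lemma variance_bessel d (f : euclidean R d -> R) (L : R) : (0 < d)%N -> 0 < L ->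
  measurable_fun setT f ->
  (((L ^+ (d - 1))^-1)%:E * linear_statistic_variance (bessel_kernel L) f =
  ((2 * pi ^+ d.+1)^-1)%:E * \int[product_measure1 (lebesgue_euclidean R d)
     (lebesgue_euclidean R d)]_z
    (gagliardo_weight d f z * profile d (L * pi * Defs.edist z.1 z.2))%:E)%E.
Proof.
move=> d0 L0 mf; have p0 := pi_gt0 R.
rewrite /linear_statistic_variance.
have -> : (fun z : euclidean R d * euclidean R d =>
    (`|f z.1 - f z.2| ^+ 2 * `|bessel_kernel L z.1 z.2| ^+ 2)%:E) =
  (fun z => (L ^+ (d - 1) / pi ^+ d.+1)%:E * (gagliardo_weight d f z *
     profile d (L * pi * Defs.edist z.1 z.2))%:E)%E.
  apply/funext => z; rewrite -EFinM bessel_kernel_phi//; congr EFin.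
  rewrite /gagliardo_weight /profile.
  have [e|ne] := eqVneq z.1 z.2.
    by rewrite e subrr normr0 expr0n/= !mul0r mulr0.
  have r0 := euclidean_dist_gt0 _ _ _ ne.
  rewrite normrM exprMn !real_normK ?num_real//.
  have -> : L ^+ d = L * L ^+ (d - 1) by rewrite -exprS subn1 prednK.
  rewrite !exprMn.
  have -> : L ^+ d.+1 = L * (L * L ^+ (d - 1)).
    by rewrite -!exprS subn1 prednK.
  have hp : pi ^+ d.+1 != 0 :> R by rewrite expf_neq0// gt_eqF.
  have hr : Defs.edist z.1 z.2 ^+ d.+1 != 0 by rewrite expf_neq0// gt_eqF.
  set a := pi ^+ d.+1 in hp *; set b := Defs.edist z.1 z.2 ^+ d.+1 in hr *.
  generalize (phi d (L * pi * Defs.edist z.1 z.2)) => p.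
  move: a b hp hr => a b hp hr; field.
  by rewrite hp hr.
have c0 : 0 <= L ^+ (d - 1) / pi ^+ d.+1.
  by rewrite divr_ge0// exprn_ge0// ltW.
rewrite ge0_integralZl//; last 2 first.
- apply/measurable_EFinP; apply: measurable_funM.
    exact: measurable_gagliardo_weight.
  apply: (measurableT_comp (f := profile d)).
    by apply: continuous_measurable_fun; exact: continuous_profile.
  by apply: measurable_funM => //; exact: measurable_euclidean_dist.
- move=> z _; rewrite lee_fin mulr_ge0 ?gagliardo_weight_ge0//.
  rewrite mulr_ge0 ?sqr_ge0// exprn_ge0// !mulr_ge0 ?(ltW L0) ?(ltW p0)//.
  exact: euclidean_dist_ge0.
rewrite !muleA -!EFinM; congr (_%:E * _)%E.
have : pi ^+ d.+1 != 0 :> R by rewrite expf_neq0// gt_eqF.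
have : L ^+ (d - 1) != 0 by rewrite expf_neq0// gt_eqF.
generalize (pi ^+ d.+1 : R) (L ^+ (d - 1)) => a b h1 h2; field.
by rewrite h1 h2.
Qed.

(** Sigma-finiteness of the product measure in the increasing form used for
    truncations. *)
Lemma product_exhaustion d : exists B : nat -> set (euclidean R d * euclidean R d),
  [/\ setT = \bigcup_i B i, nondecreasing_seq B & forall i, measurable (B i) /\
    ((product_measure1 (lebesgue_euclidean R d) (lebesgue_euclidean R d)) (B i)
      < +oo)%E].
Proof.
have /sigma_finiteP[F [TF ndF Foo]] := @sigma_finiteT _ _ _ (lebesgue_euclidean R d).
exists (fun i => F i `*` F i); split.
- apply/seteqP; split => // -[x y] _.
  have [i _ Fx] : (\bigcup_i F i) x by rewrite -TF.
  have [j _ Fy] : (\bigcup_i F i) y by rewrite -TF.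
  exists (maxn i j) => //; split => /=.
    by move: Fx; exact/subsetPset/ndF/leq_maxl.
  by move: Fy; exact/subsetPset/ndF/leq_maxr.
- move=> i j ij; apply/subsetPset => -[x y] [/= Fx Fy]; split => /=.
    by move: Fx; exact/subsetPset/ndF.
  by move: Fy; exact/subsetPset/ndF.
move=> i; have [mF Fi] := Foo i; split; first exact: measurableX.
by rewrite product_measure1E// lte_mul_pinfty// ge0_fin_numE.
Qed.

(** [radial_average] with the oscillating part [osc] / 2: the profile minus it is
    half of the energy.  Positive dimension enters through the oscillation along
    the first coordinate. *)
Lemma cvg_weighted_profile d (f : euclidean R d.+1 -> R) (l : nat -> R) :
  measurable_fun setT f -> (forall n, 0 < l n) -> l n @[n --> \oo] --> +oo ->
  (\int[product_measure1 (lebesgue_euclidean R d.+1) (lebesgue_euclidean R d.+1)]_z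
    (gagliardo_weight d.+1 f z * profile d.+1 (l n * Defs.edist z.1 z.2))%:E
    @[n --> \oo] --> (energy_lim d.+1 / 2)%:E * gagliardo_half f)%E.
Proof.
move=> mf l0 loo.
have [C hC] := @energy_bounded R d.+1.
have e0 : 0 < energy_lim d.+1 :> R.
  rewrite energy_lim_Gamma; have := Gamma_half_gt0 (R := R) d.+1 => g0.
  by rewrite divr_gt0 ?pi_gt0// mulr_gt0// exprn_gt0.
have bound (s c1 c2 : R) : 0 <= s -> `|c1| <= 1 -> `|c2| <= 1 ->
    `|s ^+ d.+2 * (c1 * phi d.+1 s ^+ 2 + c2 * dphi d.+1 s ^+ 2)| <= C.
  move=> s0 h1 h2; apply: le_trans (hC s s0).
  rewrite normrM (ger0_norm (exprn_ge0 _ s0)) ler_wpM2l ?exprn_ge0//.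
  apply: (le_trans (ler_normD _ _)); rewrite (normrM c1) (normrM c2) !(ger0_norm (sqr_ge0 _)).
  by apply: lerD; rewrite ler_piMl ?sqr_ge0.
have oscC (s : R) : 0 <= s -> `|osc d.+1 s| <= C.
  move=> s0; have := bound s 1 (-1) s0; rewrite normrN1 normr1 => /(_ (lexx _) (lexx _)).
  by rewrite mul1r mulN1r.
have primC (s : R) : 0 <= s -> `|osc_prim d.+1 s| <= C.
  move=> s0; apply: le_trans (hC s s0).
  rewrite /osc_prim normrN normrM (ger0_norm (exprn_ge0 _ s0)) ler_wpM2l ?exprn_ge0//.
  apply: (le_trans (norm_mul_le_sqr _ _)); rewrite ler_piMr ?addr_ge0 ?sqr_ge0//.
  by rewrite invf_le1// ler1n.
apply: (radial_average _ _ _ _ _ _ (profile d.+1) (fun s => 2^-1 * osc d.+1 s) C) => //.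
- exact: measurable_euclidean_dist.
- by move=> z; exact: euclidean_dist_ge0.
- exact: continuous_profile.
- by move=> s; apply: cvgMr; exact: continuous_osc.
- move=> s s0; have := bound s 1 0 s0; rewrite normr1 normr0 mul0r addr0 mul1r.
  by apply.
- move=> s s0; rewrite normrM ger0_norm// (le_trans _ (oscC s s0))//.
  by rewrite ler_piMl// invf_le1// ler1n.
- by move=> s s0; apply: mulr_ge0; [exact: exprn_ge0|exact: sqr_ge0].
- have h : 2^-1 * energy d.+1 s @[s --> +oo] --> (2^-1 * energy_lim d.+1 : R).
    by apply: cvgMr; exact: cvg_energy.
  rewrite [_ / 2]mulrC; apply: cvg_trans h; apply: near_eq_cvg; apply: nearW => s.
  by rewrite /profile /osc /energy; field.
- by rewrite divr_gt0.
- move=> F Fi.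
  apply: (weak_null_euclidean_pairs (fun s => 2^-1 * osc_prim d.+1 s)
    (fun s => 2^-1 * osc d.+1 s) C) => //.
  + move=> s; have h := is_derive_osc_prim d.+1 s.
    by derive_all => /=; rewrite mul0r add0r.
  + by move=> s; apply: cvgMr; exact: continuous_osc.
  + move=> s s0; rewrite normrM ger0_norm// (le_trans _ (primC s s0))//.
    by rewrite ler_piMl// invf_le1// ler1n.
  + move=> s s0; rewrite normrM ger0_norm// (le_trans _ (oscC s s0))//.
    by rewrite ler_piMl// invf_le1// ler1n.
- exact: product_exhaustion.
- exact: measurable_gagliardo_weight.
- by move=> z; exact: gagliardo_weight_ge0.
- move=> z /euclidean_dist_eq0 e; by rewrite /gagliardo_weight e subrr normr0 expr0n/= mul0r.
Qed.

End variance.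

Theorem proposition2p12 (R : realType) (d : nat) (hd : (1 <= d)%N)
    (f : euclidean R d -> R)
    (hf : f \in Lfun (lebesgue_euclidean R d) 2%:E) :
  let rescaled_variance (L : R) : \bar R :=
    (((L ^+ (d - 1))^-1)%:E
      * linear_statistic_variance (bessel_kernel L) f)%E in
  (rescaled_variance L @[L --> +oo] -->
     ((2 ^+ (d - 1) * Gamma (d%:R / 2 + 1) ^+ 2 / pi ^+ (d + 2))%:E
      * gagliardo_half f)%E)
  /\ ((lim (rescaled_variance L @[L --> +oo])) \is a fin_num
        <-> Sobolev_half f).
Proof.
move=> rv.
have mf : measurable_fun setT f.
  by have := sub_Lfun_mfun hf; rewrite inE.
set K := (2 ^+ (d - 1) * Gamma (d%:R / 2 + 1) ^+ 2 / pi ^+ (d + 2)).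
have p0 : 0 < pi :> R := pi_gt0 R.
have G0 := Gamma_half_gt0 (R := R) d.
have K0 : 0 < K by rewrite divr_gt0 ?mulr_gt0 ?exprn_gt0.
have gag0 : (0 <= gagliardo_half f)%E.
  by apply: integral_ge0 => z _; rewrite lee_fin; exact: gagliardo_weight_ge0.
have KE : K = (2 * pi ^+ d.+1)^-1 * (energy_lim d / 2).
  rewrite /K energy_lim_Gamma addn2 -[in 2 ^+ d.+1](subnK hd) addn1 !exprS.
  have : pi ^+ d != 0 :> R by rewrite expf_neq0// gt_eqF.
  have : pi != 0 :> R by rewrite gt_eqF.
  generalize (Gamma (d%:R / 2 + 1) : R) (pi ^+ d : R) (@pi R) (2 ^+ (d - 1) : R).
  by move=> a b c e h1 h2; field; rewrite h1 h2.
have cvg_rv : rv L @[L --> +oo] --> (K%:E * gagliardo_half f)%E.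
  apply/cvge_pinftyP => u uoo.
  (* w agrees with u eventually and is positive for every index. *)
  pose w n := Num.max (u n) 1.
  have w0 n : 0 < w n by rewrite lt_max ltr01 orbT.
  have woo : w n @[n --> \oo] --> +oo.
    apply/cvgryPge => A; have /cvgryPge/(_ A) := uoo.
    by apply: filterS => n An; rewrite le_max An.
  have wpi : w n * pi @[n --> \oo] --> +oo.
    apply/cvgryPge => A; have /cvgryPge/(_ (A / pi)) := woo.
    by apply: filterS => n; rewrite ler_pdivrMr.
  have wpi0 n : 0 < w n * pi by rewrite mulr_gt0.
  have h : (((2 * pi ^+ d.+1)^-1)%:E * \int[product_measure1 (lebesgue_euclidean R d)
     (lebesgue_euclidean R d)]_z
    (gagliardo_weight d f z * profile d (w n * pi * Defs.edist z.1 z.2))%:E)%E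
     @[n --> \oo] --> (((2 * pi ^+ d.+1)^-1)%:E * ((energy_lim d / 2)%:E * gagliardo_half f))%E.
    apply: cvgeZl => //.
    case: d hd f hf mf {rv gag0 K KE K0 G0} => // d _ f _ mf.
    exact: cvg_weighted_profile.
  rewrite KE EFinM -muleA; apply: cvg_trans h; apply: near_eq_cvg.
  have /cvgryPge/(_ 1) := uoo; apply: filterS => n un.
  have -> : w n = u n by rewrite /w max_l.
  by rewrite -variance_bessel// (lt_le_trans ltr01).
split; first exact: cvg_rv.
rewrite (cvg_lim _ cvg_rv)//; split.
- move=> fin; split; first exact: hf.
  rewrite ltey; apply/eqP => e; move: fin; rewrite e gt0_muley ?lte_fin//.
- move=> [_ lt]; rewrite fin_numM// ge0_fin_numE//.
Qed.
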